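(* Consider a finite average-reward Markov decision process with state space $\mathcal{S}$, action space $\mathcal{A}$, transition probabilities $p(j|i,u)$ and rewards $g(i,u,j)\in[0,\overline g]$, such that for every stationary policy $\mu:\mathcal{S}\to\mathcal{A}$ the induced Markov chain with transition probabilities $P_{i,j}=p(j|i,\mu(i))$ has a single recurrent class. Let $\overline r$ be the optimal average reward, and let $(Q_n)_{n\geq0}$ be generated by the RVI-$Q$-learning iteration $$Q_n(i,u)=(1-\alpha_n)Q_{n-1}(i,u)+\alpha_n\Big[g(i,u,\xi^n_{iu})+\max_{u'\in\mathcal{A}}Q_{n-1}(\xi^n_{iu},u')-f(Q_{n-1})\Big]$$ for $(i,u)\in\mathcal{S}\times\mathcal{A}$, $n\geq1$, from $Q_0\in\mathbb{R}^d$, with stepsizes $\alpha_n=1/(n+1)^a$ where $\frac45<a\leq1$. Then, almost surely, $f(Q_n)\to\overline r$ and $Q_n\to Q^*\in\mathrm{Fix}(H)$, where $Q^*$ is the unique fixed point of $H$ satisfying $f(Q^* )=\overline r$. Moreover, there exists a constant $\kappa_a$ (independent of $n$) such that for all $n\ge 1$ $$\mathbb{E}(\|Q_n-H(Q_n)\|_\infty)\leq\frac{\kappa_a}{\sqrt{\tau_n}},$$ where $\tau_n=\sum_{k=1}^n\alpha_k(1-\alpha_k)$; this bound is of order $O(1/\sqrt{n^{1-a}})$ if $\frac45<a<1$ and $O(1/\sqrt{\log n})$ if $a=1$.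
   Context: $\mathcal{S}$ and $\mathcal{A}$ are finite sets, $d=|\mathcal{S}\times\mathcal{A}|$, and $p(\cdot|i,u)$ is a probability distribution on $\mathcal{S}$ giving the probability of moving to $j$ when action $u$ is chosen at state $i$; $g(i,u,j)$ is the reward for this transition, with $0\leq g\leq\overline g$ (ensured by adding a constant to the rewards). For a stationary policy $\mu$, with $u_t=\mu(i_t)$ and $i_{t+1}\sim p(\cdot|i_t,u_t)$, set $R_\mu(i_0)=\liminf_{N\to\infty}\mathbb{E}\big[\frac1N\sum_{t=0}^{N-1}g(i_t,u_t,i_{t+1})\big]$; under the single-recurrent-class assumption this does not depend on $i_0$, and $\overline r=\max_\mu R_\mu(i_0)$. The map $H:\mathbb{R}^d\to\mathbb{R}^d$ is $$H(Q)(i,u)=\sum_{j\in\mathcal{S}}p(j|i,u)\big(g(i,u,j)+\max_{u'\in\mathcal{A}}Q(j,u')\big)-\overline r .$$ It is nonexpansive for $\|\cdot\|_\infty$, and under the stated assumption its fixed points (solutions of the Bellman equation $Q=H(Q)$) exist and are unique up to addition of a constant multiple of the all-ones vector $e\in\mathbb{R}^d$. $f:\mathbb{R}^d\to\mathbb{R}$ is a fixed continuous function with $f(Q+c\,e)=f(Q)+c$ for all $Q\in\mathbb{R}^d$, $c\in\mathbb{R}$. The samples $\xi^n_{iu}\sim p(\cdot|i,u)$ are independent over all $n\geq1$ and $(i,u)\in\mathcal{S}\times\mathcal{A}$. *)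

(* Defs.v *)
From HB Require Import structures.
From mathcomp Require Import all_boot all_order all_algebra.
From mathcomp Require Import all_classical all_reals all_analysis.

Set Implicit Arguments.
Unset Strict Implicit.
Unset Printing Implicit Defensive.

Import Order.TTheory GRing.Theory Num.Theory.
Import numFieldNormedType.Exports.

Local Open Scope classical_set_scope.
Local Open Scope ring_scope.

(* Maximum of F over a nonempty finite type; x0 only witnesses nonemptiness,
   the value does not depend on it. *)
Definition fmax (R : realType) (T : finType) (x0 : T) (F : T -> R) : R :=
  \big[Num.max/F x0]_(x : T) F x.

Fixpoint nstep (R : realType) (S : finType) (M : S -> S -> R) (n : nat)
    (i j : S) : R :=
  if n is m.+1 then \sum_(k : S) M i k * nstep M m k j else (i == j)%:R.

Definition accessible (R : realType) (S : finType) (M : S -> S -> R)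
    (i j : S) : Prop :=
  exists n : nat, 0 < nstep M n i j.

(* For a chain on a finite state space, a recurrent class is a nonempty set of
   pairwise communicating states that cannot be left. *)
Definition recurrent_class (R : realType) (S : finType) (M : S -> S -> R)
    (C : {set S}) : Prop :=
  [/\ exists i, i \in C,
      forall i j, i \in C -> j \in C -> accessible M i j
    & forall i j, i \in C -> j \notin C -> ~ accessible M i j].

Definition unichain (R : realType) (S A : finType) (p : S -> A -> S -> R) :
    Prop :=
  forall mu : {ffun S -> A},
    exists! C : {set S}, recurrent_class (fun i j => p i (mu i) j) C.

(* Probability that the chain of the policy mu started at i0 follows the
   trajectory w = (w_0, ..., w_N). *)
Definition traj_prob (R : realType) (S A : finType) (p : S -> A -> S -> R)
    (mu : {ffun S -> A}) (i0 : S) (N : nat) (w : {ffun 'I_N.+1 -> S}) : R :=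
  (w ord0 == i0)%:R *
  \prod_(t < N) p (w (inord t)) (mu (w (inord t))) (w (inord t.+1)).

(* E[(1/N) \sum_(t < N) g(i_t, u_t, i_(t+1))], the expectation being the sum
   over the finitely many trajectories of length N. *)
Definition mean_reward (R : realType) (S A : finType) (p g : S -> A -> S -> R)
    (mu : {ffun S -> A}) (i0 : S) (N : nat) : R :=
  \sum_(w : {ffun 'I_N.+1 -> S}) traj_prob p mu i0 w *
    (N%:R^-1 *
     \sum_(t < N) g (w (inord t)) (mu (w (inord t))) (w (inord t.+1))).

Definition avg_reward (R : realType) (S A : finType) (p g : S -> A -> S -> R)
    (mu : {ffun S -> A}) (i0 : S) : R :=
  limn_inf (fun N => mean_reward p g mu i0 N).

Definition opt_reward (R : realType) (S A : finType) (a0 : A)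
    (p g : S -> A -> S -> R) (i0 : S) : R :=
  fmax [ffun=> a0] (fun mu : {ffun S -> A} => avg_reward p g mu i0).

(* R^d with d = #|S * A|: row vectors, whose library norm is the sup norm. The
   coordinate of (i, u) is reached through the enumeration of S * A. *)
Notation Qspace R S A := 'rV[R]_#|{: S * A}|.

Definition qval (R : realType) (S A : finType) (Q : Qspace R S A)
    (i : S) (u : A) : R :=
  Q ord0 (enum_rank (i, u)).

Definition mkQ (R : realType) (S A : finType) (F : S -> A -> R) :
    Qspace R S A :=
  \row_k F (enum_val k).1 (enum_val k).2.

Definition bellmanH (R : realType) (S A : finType) (a0 : A)
    (p g : S -> A -> S -> R) (rbar : R) (Q : Qspace R S A) : Qspace R S A :=
  mkQ (fun i u =>
    (\sum_(j : S) p i u j * (g i u j + fmax a0 (fun u' => qval Q j u')))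
    - rbar).

(* x n i u is the successor state sampled for (i, u) at step n >= 1. *)
Fixpoint rviQ (R : realType) (S A : finType) (a0 : A) (g : S -> A -> S -> R)
    (f : Qspace R S A -> R) (alpha : nat -> R) (Q0 : Qspace R S A)
    (x : nat -> S -> A -> S) (n : nat) : Qspace R S A :=
  if n is m.+1 then
    let Q := rviQ a0 g f alpha Q0 x m in
    mkQ (fun i u =>
      (1 - alpha n) * qval Q i u +
      alpha n * (g i u (x n i u) + fmax a0 (fun u' => qval Q (x n i u) u')
                 - f Q))
  else Q0.

Definition stepsize (R : realType) (a : R) (n : nat) : R :=
  1 / (n.+1%:R `^ a).

Definition tau (R : realType) (alpha : nat -> R) (n : nat) : R :=
  \sum_(1 <= k < n.+1) alpha k * (1 - alpha k).

(* Mutual independence of the finitely-valued random variables X k, k in D. *)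
Definition mutually_independent (d : measure_display) (T : measurableType d)
    (R : realType) (P : probability T R) (I : choiceType) (V : finType)
    (D : set I) (X : I -> T -> V) : Prop :=
  forall (s : seq I) (B : I -> set V),
    uniq s -> [set` s] `<=` D ->
    P (\bigcap_(k in [set` s]) (X k @^-1` B k)) =
    (\big[*%E/1%E]_(k <- s) P (X k @^-1` B k))%E.

(* Main.v *)
Require Import Defs.
From HB Require Import structures.
From mathcomp Require Import all_boot all_order all_algebra.
From mathcomp Require Import all_classical all_reals all_analysis.
From mathcomp Require Import measurable_realfun ring lra zify.

(** The proof rests on a contraction property that the unichain assumption gives
    to the Bellman operator [H] modulo constant vectors, stronger than its
    nonexpansiveness.

    Differences of values of [H] are one-step averages of a randomised policy
    ([bellman_diff]). Make each step lazy, i.e. mix it with the identity with a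
    fixed weight. Run lazy steps of arbitrary policies and suppose that one
    coordinate stays almost maximal and another almost minimal. Followed
    backwards, the sets of coordinates responsible for this are disjoint and
    cannot both be closed under a policy, since a policy has only one recurrent
    class; hence they grow until they no longer fit into [S * A]. So
    [#|S * A|] lazy steps shrink the oscillation by a fixed factor
    ([lazy_run_scrambling]), and a weighted supremum of oscillations along runs
    is a seminorm, with the constant vectors as its kernel, that every single
    lazy step contracts ([contracting_seminorm]). For a stepsize [al] at most
    [stepsize a 1], the averaged step [Q |-> (1 - al) * Q + al * H Q] is a convex
    combination of the identity and a lazy step, so it contracts this seminorm by
    the factor [1 - rate * al] ([averaged_step_contraction]).

    Existence and uniqueness, up to constants, of solutions of the Bellman
    equation follow as for Banach's theorem, and comparing total rewards with the
    relative values shows that its constant is the optimal average reward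
    ([bellman_fixed_exists], [bellman_fixed_unique], [opt_reward_fixed]).

    For the random iteration, let [avg_noise] be the average of the past noise
    with the same stepsizes. Subtracting it from the iterates leaves a
    recursion that contracts up to an error proportional to [avg_noise]. The noise
    is centred given the past and its size is controlled by the distance of the
    iterate to the solutions. Hence the second moments of the denoised distance
    and of [avg_noise], combined linearly, satisfy a recursion
    [W' <= (1 - c * al + C * al ^+ 2) * W + C * al ^+ 2], whose solutions are
    bounded and of order [1 / tau] ([second_moment_rate], [moments_rate]). This
    gives the bound on the mean residual. The same recursion makes [avg_noise]
    of second moment [n `^ (- 3 / 5)], which is summable along the squares;
    between consecutive squares it moves little, so it tends to 0 almost surely
    ([avg_noise_cvg0]). On such a path the iterates approach the solutions modulo
    constants, and the term [f] then selects the one with [f Qstar = rbar]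
    ([iterates_cvg]). *)

Set Implicit Arguments.
Unset Strict Implicit.
Unset Printing Implicit Defensive.

Import Order.TTheory GRing.Theory Num.Theory.
Import numFieldNormedType.Exports.

Local Open Scope classical_set_scope.
Local Open Scope ring_scope.

(** * Closed classes of a finite chain *)

Section Chains.
Variables (R : realType) (S : finType) (M : S -> S -> R).
Hypothesis M_ge0 : forall i j, 0 <= M i j.

Definition closed_class (C : {set S}) : Prop :=
  forall i j, i \in C -> 0 < M i j -> j \in C.

Lemma nstep_ge0 n i j : 0 <= nstep M n i j.
Proof.
elim: n i => [|n IH] i /=; first by rewrite ler0n.
by apply: sumr_ge0 => k _; rewrite mulr_ge0.
Qed.

Lemma nstepS_gt0 n i k j :
  0 < M i k -> 0 < nstep M n k j -> 0 < nstep M n.+1 i j.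
Proof.
move=> Mik Mkj /=; rewrite (bigD1 k)//= ltr_pwDl ?mulr_gt0//.
by apply: sumr_ge0 => l _; rewrite mulr_ge0 ?nstep_ge0.
Qed.

Lemma sumr_gt0_ex (T : finType) (F : T -> R) :
  (forall x, 0 <= F x) -> 0 < \sum_x F x -> exists x, 0 < F x.
Proof.
move=> F0 sF; apply/existsP; apply: contraLR sF => /existsPn nF.
rewrite -leNgt (eq_bigr (fun=> 0)) ?big1// => x _.
by apply/eqP; rewrite eq_le F0 andbT leNgt nF.
Qed.

Lemma accessible_step i j k : accessible M i j -> 0 < M j k ->
  accessible M i k.
Proof.
move=> [n]; elim: n i => [|n IH] i /=.
  have [-> _ Mk|_] := eqVneq i j; last by rewrite ltxx.
  exists 1%N; apply: (nstepS_gt0 Mk) => /=.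
  by rewrite eqxx ltr01.
move=> + Mjk => /sumr_gt0_ex[l|l].
  by rewrite mulr_ge0 ?nstep_ge0.
rewrite lt_neqAle eq_sym mulf_eq0 negb_or => /andP[/andP[Mil0 nl0] _].
have Mil : 0 < M i l by rewrite lt_neqAle eq_sym Mil0 M_ge0.
have [|//|m Hm] := IH l; first by rewrite lt_neqAle eq_sym nl0 nstep_ge0.
by exists m.+1; exact: nstepS_gt0 Mil Hm.
Qed.

Lemma closed_class_accessible C i j :
  closed_class C -> i \in C -> accessible M i j -> j \in C.
Proof.
move=> cC iC [n]; elim: n i iC => [|n IH] i iC /=.
  by have [<-//|] := eqVneq i j; rewrite ltxx.
move=> /sumr_gt0_ex[l|l].
  by rewrite mulr_ge0 ?nstep_ge0.
rewrite lt_neqAle eq_sym mulf_eq0 negb_or => /andP[/andP[Mil0 nl0] _].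
apply: (IH l); last by rewrite lt_neqAle eq_sym nl0 nstep_ge0.
by apply: (cC i) => //; rewrite lt_neqAle eq_sym Mil0 M_ge0.
Qed.

(** The states reachable from a point form a closed set, so a closed set of
    least cardinality is a single communicating class. *)
Lemma closed_class_recurrent C : closed_class C -> (exists i, i \in C) ->
  exists2 C', recurrent_class M C' & C' \subset C.
Proof.
elim: {C}#|C| {-2}C (leqnn #|C|) => [|n IH] C cardC cC [i iC].
  by move: cardC; rewrite leqn0 cards_eq0 => /eqP C0; rewrite C0 inE in iC.
have [commC|] := pselect (forall i j, i \in C -> j \in C -> accessible M i j).
  exists C => //; split=> //; first by exists i.
  by move=> k l kC /negP lC; apply: contra_not lC => /closed_class_accessible; apply.
move=> /existsNP[k /existsNP[l /not_implyP[kC /not_implyP[lC nkl]]]].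
pose C1 := [set j in C | `[< accessible M k j >]].
have C1C : C1 \subset C by apply/fintype.subsetP => x; rewrite inE => /andP[].
have ltC1 : (#|C1| < #|C|)%N.
  apply: proper_card; apply/properP; split=> //; exists l => //.
  by rewrite inE lC /=; apply/asboolPn.
have [|||C' rC' C'C1] := IH C1.
- by rewrite -ltnS (leq_trans ltC1).
- move=> x y; rewrite !inE => /andP[xC /asboolP kx] Mxy.
  rewrite (cC _ _ xC Mxy)/=; apply/asboolP; exact: accessible_step kx Mxy.
- exists k; rewrite inE kC/=; apply/asboolP; exists 0%N => /=.
  by rewrite eqxx ltr01.
by exists C' => //; exact: fintype.subset_trans C'C1 C1C.
Qed.

(** Each of the two sets contains a recurrent class, and there is only one. *)
Lemma closed_classes_meet (C1 C2 : {set S}) :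
  (exists! C : {set S}, recurrent_class M C) ->
  closed_class C1 -> closed_class C2 ->
  (exists i, i \in C1) -> (exists i, i \in C2) ->
  exists i, i \in C1 :&: C2.
Proof.
move=> [C [rC uC]] c1 c2 n1 n2.
have [D1 r1 s1] := closed_class_recurrent c1 n1.
have [D2 r2 s2] := closed_class_recurrent c2 n2.
move: (rC) => [[i iC] _ _]; exists i.
by rewrite inE (fintype.subsetP s1) -?(uC _ r1)// (fintype.subsetP s2) -?(uC _ r2).
Qed.

End Chains.

(** * Lazy steps of randomised policies *)

Section FiniteAux.
Variable R : realType.

Lemma pos_lower_bound (T : finType) (F : T -> R) :
  exists2 m, 0 < m & forall x, 0 < F x -> m <= F x.
Proof.
pose s := \sum_(x | 0 < F x) (F x)^-1.
have s0 : 0 <= s by apply: sumr_ge0 => x Fx; rewrite invr_ge0 ltW.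
exists (1 + s)^-1; first by rewrite invr_gt0 ltr_pwDl.
move=> x Fx; rewrite -[leRHS]invrK lef_pV2 ?posrE ?invr_gt0 ?ltr_pwDl//.
rewrite /s (bigD1 x)//= addrCA lerDl addr_ge0//.
by apply: sumr_ge0 => y /andP[Fy _]; rewrite invr_ge0 ltW.
Qed.

Lemma bernoulli_ineq (x : R) n : 0 <= x -> x <= 1 -> 1 - n%:R * x <= (1 - x) ^+ n.
Proof.
move=> x0 x1; elim: n => [|n IH]; first by rewrite mul0r subr0 expr0.
rewrite exprS; apply: (@le_trans _ _ ((1 - x) * (1 - n%:R * x))).
  rewrite -natr1; have : 0 <= n%:R * x * x by rewrite !mulr_ge0.
  by lra.
by rewrite ler_wpM2l// subr_ge0.
Qed.

End FiniteAux.

Section Policies.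
Variables (R : realType) (S A : finType).

(** Policies are randomised because a difference of two maxima over the actions
    is an average over the actions, not the value at one of them. *)
Record policy := Policy {
  pol :> S -> A -> R;
  pol_ge0 : forall j u, 0 <= pol j u;
  pol_sum1 : forall j, \sum_u pol j u = 1 }.

Lemma policy_likely (nu : policy) j : exists u, (#|A|%:R)^-1 <= nu j u.
Proof.
apply: contrapT => /forallNP h.
have /lt_eqF : \sum_u nu j u < \sum_(u : A) (#|A|%:R)^-1.
  apply: ltr_sum; last by move=> u _; rewrite ltNge; exact/negP.
  have [u _|A0] := pickP (mem A); first by apply/hasP; exists u; rewrite ?mem_index_enum.
  move: (pol_sum1 nu j); rewrite big_pred0 => [/eqP|u]; last by have := A0 u.
  by rewrite eq_sym oner_eq0.
have [u _|A0] := pickP (mem A); last first.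
  move: (pol_sum1 nu j); rewrite big_pred0 => [/eqP|u]; last by have := A0 u.
  by rewrite eq_sym oner_eq0.
have -> : \sum_(u : A) (#|A|%:R)^-1 = 1 :> R.
  rewrite sumr_const -[_ *+ _]mulr_natr; apply: mulVf.
  by rewrite pnatr_eq0; apply/eqP => /card0_eq/(_ u).
by rewrite pol_sum1 eqxx.
Qed.

End Policies.

Section Scrambling.
Variables (R : realType) (S A : finType) (p : S -> A -> S -> R).
Hypothesis p_ge0 : forall i u j, 0 <= p i u j.
Hypothesis p_sum1 : forall i u, \sum_j p i u j = 1.
Hypothesis p_unichain : unichain p.
Variable lam : R.
Hypothesis lam_gt0 : 0 < lam.
Hypothesis lam_lt1 : lam < 1.

Notation Qs := (Qspace R S A).
Notation pol := (policy R S A).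

Definition next_mean (v : S -> R) : Qs := mkQ (fun i u => \sum_j p i u j * v j).

Definition pol_avg (nu : pol) (D : Qs) (j : S) : R :=
  \sum_u nu j u * qval D j u.

Definition lazy_step (nu : pol) (D : Qs) : Qs :=
  (1 - lam) *: D + lam *: next_mean (pol_avg nu D).

Definition lazy_run (s : seq pol) (D : Qs) : Qs :=
  foldl (fun E nu => lazy_step nu E) D s.

Lemma next_meanE v k :
  next_mean v ord0 k = \sum_j p (enum_val k).1 (enum_val k).2 j * v j.
Proof. by rewrite mxE. Qed.

Lemma lazy_stepE nu D k : lazy_step nu D ord0 k =
  (1 - lam) * D ord0 k + lam * next_mean (pol_avg nu D) ord0 k.
Proof. by rewrite !mxE. Qed.

Lemma next_mean_comb a b v w : next_mean (fun j => a * v j + b * w j) =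
  a *: next_mean v + b *: next_mean w.
Proof.
apply/rowP => k; rewrite !mxE !mulr_sumr -big_split/=.
by apply: eq_bigr => j _; ring.
Qed.

Lemma next_mean_cst c : next_mean (fun=> c) = const_mx c.
Proof. by apply/rowP => k; rewrite !mxE -mulr_suml p_sum1 mul1r. Qed.

Lemma next_mean_mono v w k : (forall j, v j <= w j) ->
  next_mean v ord0 k <= next_mean w ord0 k.
Proof.
by move=> vw; rewrite !mxE; apply: ler_sum => j _; rewrite ler_wpM2l.
Qed.

Lemma pol_avg_comb nu a b D E j : pol_avg nu (a *: D + b *: E) j =
  a * pol_avg nu D j + b * pol_avg nu E j.
Proof.
rewrite /pol_avg !mulr_sumr -big_split/=.
by apply: eq_bigr => u _; rewrite /qval !mxE; ring.
Qed.

Lemma pol_avg_cst nu c j : pol_avg nu (const_mx c) j = c.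
Proof.
rewrite -[RHS]mul1r -(pol_sum1 nu j) mulr_suml.
by apply: eq_bigr => u _; rewrite /qval mxE.
Qed.

Lemma pol_avg_mono nu (D E : Qs) j : (forall k, D ord0 k <= E ord0 k) ->
  pol_avg nu D j <= pol_avg nu E j.
Proof.
move=> DE; apply: ler_sum => u _.
by rewrite ler_wpM2l ?pol_ge0//; exact: DE.
Qed.

Lemma lazy_comb nu a b D E :
  lazy_step nu (a *: D + b *: E) = a *: lazy_step nu D + b *: lazy_step nu E.
Proof.
rewrite /lazy_step.
rewrite (_ : pol_avg nu _ = fun j => a * pol_avg nu D j + b * pol_avg nu E j).
  by rewrite next_mean_comb; apply/rowP => k; rewrite !mxE; ring.
by apply/funext => j; exact: pol_avg_comb.
Qed.

Lemma lazy_cst nu c : lazy_step nu (const_mx c) = const_mx c.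
Proof.
rewrite /lazy_step (_ : pol_avg nu _ = fun=> c); last first.
  by apply/funext => j; exact: pol_avg_cst.
by rewrite next_mean_cst -scalerDl subrK scale1r.
Qed.

Lemma lazy_mono nu (D E : Qs) : (forall k, D ord0 k <= E ord0 k) ->
  forall k, lazy_step nu D ord0 k <= lazy_step nu E ord0 k.
Proof.
move=> DE k; rewrite !lazy_stepE lerD// ler_wpM2l//.
- by rewrite subr_ge0 ltW.
- by rewrite ltW.
- by apply: next_mean_mono => j; exact: pol_avg_mono.
Qed.

Lemma lazy_run_comb s a b D E :
  lazy_run s (a *: D + b *: E) = a *: lazy_run s D + b *: lazy_run s E.
Proof. by elim: s D E => //= nu s IH D E; rewrite lazy_comb IH. Qed.

Lemma lazy_run_cst s c : lazy_run s (const_mx c) = const_mx c.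
Proof. by elim: s => //= nu s IH; rewrite lazy_cst. Qed.

Lemma lazy_run_mono s (D E : Qs) : (forall k, D ord0 k <= E ord0 k) ->
  forall k, lazy_run s D ord0 k <= lazy_run s E ord0 k.
Proof.
by elim: s D E => //= nu s IH D E DE; apply: IH; exact: lazy_mono.
Qed.

Lemma lazy_run_bounds s (D : Qs) a b : (forall k, a <= D ord0 k <= b) ->
  forall k, a <= lazy_run s D ord0 k <= b.
Proof.
move=> Dab k; apply/andP; split.
  have <- : lazy_run s (const_mx a) ord0 k = a by rewrite lazy_run_cst mxE.
  by apply: lazy_run_mono => l; rewrite mxE; case/andP: (Dab l).
have <- : lazy_run s (const_mx b) ord0 k = b by rewrite lazy_run_cst mxE.
by apply: lazy_run_mono => l; rewrite mxE; case/andP: (Dab l).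
Qed.

(** If a lazy step leaves a nonnegative vector small at [k], the vector was
    small at [k] and, at each possible successor state, at an action that the
    policy plays with probability at least [1 / #|A|]; that action depends on
    the policy alone, so the successors follow a deterministic policy. *)
Lemma lazy_small : exists2 c : R, 1 <= c &
  forall nu : pol, exists mu : {ffun S -> A},
  forall (E : Qs) eta, (forall k, 0 <= E ord0 k) ->
  forall k, lazy_step nu E ord0 k <= eta ->
  E ord0 k <= c * eta /\
  (forall j, 0 < p (enum_val k).1 (enum_val k).2 j ->
     E ord0 (enum_rank (j, mu j)) <= c * eta).
Proof.
have [pm pm0 pmP] := pos_lower_bound (fun x : S * A * S => p x.1.1 x.1.2 x.2).
have l1 : 0 < 1 - lam by rewrite subr_gt0.
pose c := (1 - lam)^-1 + #|A|%:R / (lam * pm).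
have cA0 : 0 <= #|A|%:R / (lam * pm) by rewrite divr_ge0// mulr_ge0 ?ltW.
exists c.
  by rewrite /c; apply: ler_wpDr => //; rewrite invf_ge1// gerBl ltW.
move=> nu; have [mu muP] := choice (policy_likely nu).
exists [ffun j => mu j] => E eta E0 k.
set T := next_mean (pol_avg nu E) ord0 k.
have avg0 j : 0 <= pol_avg nu E j.
  by apply: sumr_ge0 => u _; rewrite mulr_ge0 ?pol_ge0//; exact: E0.
have T0 : 0 <= T.
  by rewrite /T next_meanE; apply: sumr_ge0 => j _; rewrite mulr_ge0.
rewrite lazy_stepE -/T => leta.
have e1 : (1 - lam) * E ord0 k <= eta.
  by apply: le_trans leta; rewrite lerDl mulr_ge0// ltW.
have e2 : lam * T <= eta.
  by apply: le_trans leta; rewrite lerDr mulr_ge0// ltW.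
have eta0 : 0 <= eta by apply: le_trans e2; rewrite mulr_ge0// ltW.
split.
  rewrite /c mulrDl; apply: ler_wpDr; first exact: mulr_ge0.
  by rewrite ler_pdivlMl.
move=> j pj; rewrite ffunE.
set x := E ord0 _.
have x0 : 0 <= x by exact: E0.
have A0 : 0 < #|A|%:R :> R by rewrite ltr0n; apply/card_gt0P; exists (mu j).
have t1 : pm * ((#|A|%:R)^-1 * x) <= T.
  apply: (@le_trans _ _ (p (enum_val k).1 (enum_val k).2 j * pol_avg nu E j)).
    rewrite ler_pM ?mulr_ge0 ?invr_ge0//; first exact: ltW.
      exact: (pmP (enum_val k, j)).
    rewrite /pol_avg (bigD1 (mu j))//= ler_wpDr//.
      by apply: sumr_ge0 => u _; rewrite mulr_ge0 ?pol_ge0//; exact: E0.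
    by rewrite ler_wpM2r.
  rewrite /T next_meanE (bigD1 j)//= lerDl.
  by apply: sumr_ge0 => l _; rewrite mulr_ge0.
rewrite /c mulrDl; apply: ler_wpDl; first by rewrite mulr_ge0// invr_ge0 ltW.
rewrite mulrAC ler_pdivlMr ?mulr_gt0//.
have : lam * (pm * (#|A|%:R^-1 * x)) <= eta.
  by apply: le_trans e2; rewrite ler_wpM2l// ltW.
rewrite -(ler_pM2l A0); apply: le_trans; rewrite le_eqVlt; apply/orP; left.
by apply/eqP; field; rewrite gt_eqF.
Qed.

Lemma next_mean_subset_closed (G : {set 'I_#|{: S * A}|}) (mu : {ffun S -> A}) :
  (forall k, k \in G -> forall j, 0 < p (enum_val k).1 (enum_val k).2 j ->
     enum_rank (j, mu j) \in G) ->
  (exists k, k \in G) ->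
  closed_class (fun i j => p i (mu i) j) [set j | enum_rank (j, mu j) \in G]%SET
  /\ exists j, j \in [set j | enum_rank (j, mu j) \in G]%SET.
Proof.
move=> cG [k kG]; split.
  move=> i j; rewrite !inE => iG pij; apply: cG iG _ _.
  by rewrite enum_rankK.
have [||j pj] := @sumr_gt0_ex R S (p (enum_val k).1 (enum_val k).2) => //.
  by rewrite p_sum1.
by exists j; rewrite inE; exact: cG kG _ pj.
Qed.

(** Running a product of lazy steps backwards, the coordinates from which the
    vector is almost 1 and those from which it is almost 0 form two disjoint
    sets that never shrink. If neither of them grew in a step, both would be
    closed under one deterministic policy, which would then have two recurrent
    classes. *)
Lemma scrambling_growth : exists2 c : R, 1 <= c &
  forall s (D : Qs) eta (G G' : {set 'I_#|{: S * A}|}),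
    (forall k, 0 <= D ord0 k <= 1) -> 0 <= eta -> eta * c ^+ size s < 2^-1 ->
    (exists k, k \in G) -> (exists k, k \in G') ->
    (forall k, k \in G -> 1 - eta <= lazy_run s D ord0 k) ->
    (forall k, k \in G' -> lazy_run s D ord0 k <= eta) ->
    (#|G| + #|G'| + size s <= #|{: S * A}|)%N.
Proof.
have [c c1 cP] := lazy_small; exists c => // s.
have c0 : 0 < c by exact: lt_le_trans c1.
elim/last_ind: s => [|s nu IH] D eta G G' D01 eta0 etac nG nG' hG hG'.
  rewrite addn0 -cardsUI (_ : G :&: G' = finset.set0) ?cards0 ?addn0.
    by rewrite (leq_trans (max_card _))// card_ord.
  apply/setP => k; rewrite !inE; apply/negP => /andP[/hG h1 /hG' h2].
  rewrite /= expr0 mulr1 in etac.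
  by move: h1 h2 => /=; lra.
rewrite size_rcons in etac *.
have [mu muP] := cP nu.
set U := lazy_run s D.
have U01 : forall k, 0 <= U ord0 k <= 1 by exact: lazy_run_bounds.
have runE : lazy_run (rcons s nu) D = lazy_step nu U by rewrite /lazy_run foldl_rcons.
pose G1 := [set k | 1 - c * eta <= U ord0 k]%SET.
pose G1' := [set k | U ord0 k <= c * eta]%SET.
have ceta0 : 0 <= c * eta by rewrite mulr_ge0// ltW.
have stepG k : k \in G -> k \in G1 /\
    forall j, 0 < p (enum_val k).1 (enum_val k).2 j -> enum_rank (j, mu j) \in G1.
  move=> /hG; rewrite runE => hk.
  have [||h1 h2] := muP (1 *: const_mx 1 + (-1) *: U) eta _ k.
  - by move=> l; rewrite !mxE; have := U01 l; lra.
  - by rewrite lazy_comb lazy_cst !mxE; move: hk; rewrite !mxE; lra.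
  split; first by move: h1; rewrite inE !mxE; lra.
  by move=> j /h2; rewrite inE !mxE; lra.
have stepG' k : k \in G' -> k \in G1' /\
    forall j, 0 < p (enum_val k).1 (enum_val k).2 j -> enum_rank (j, mu j) \in G1'.
  move=> /hG'; rewrite runE => hk.
  have [|//|h1 h2] := muP U eta _ k.
  - by move=> l; have /andP[] := U01 l.
  split; first by rewrite inE.
  by move=> j /h2; rewrite inE.
have GG1 : G \subset G1 by apply/fintype.subsetP => k /stepG[].
have GG1' : G' \subset G1' by apply/fintype.subsetP => k /stepG'[].
have IHb : (#|G1| + #|G1'| + size s <= #|{: S * A}|)%N.
  apply: (IH D (c * eta)) => //.
  - by rewrite -mulrA mulrCA -exprS.
  - by case: nG => k kG; exists k; exact: (fintype.subsetP GG1).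
  - by case: nG' => k kG; exists k; exact: (fintype.subsetP GG1').
  - by move=> k; rewrite inE.
  - by move=> k; rewrite inE.
(* If no set grew, each is closed under mu, against unichain. *)
have [grow|ngrow] := ltnP (#|G| + #|G'|) (#|G1| + #|G1'|).
  by rewrite addnS (leq_trans _ IHb)// -addSn leq_add2r.
have [eG eG'] : G = G1 /\ G' = G1'.
  have := subset_leq_card GG1; have := subset_leq_card GG1'.
  move=> l1 l2; split; apply/eqP.
    by rewrite eqEcard GG1/= -(leq_add2r #|G1'|) (leq_trans ngrow)// leq_add2l.
  by rewrite eqEcard GG1'/= -(leq_add2l #|G1|) (leq_trans ngrow)// leq_add2r.
have [cC nC] : closed_class (fun i j => p i (mu i) j)
    [set j | enum_rank (j, mu j) \in G]%SET /\
    exists j, j \in [set j | enum_rank (j, mu j) \in G]%SET.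
  by apply: next_mean_subset_closed => // k kG j pj; rewrite eG; apply: (stepG k kG).2.
have [cC' nC'] : closed_class (fun i j => p i (mu i) j)
    [set j | enum_rank (j, mu j) \in G']%SET /\
    exists j, j \in [set j | enum_rank (j, mu j) \in G']%SET.
  by apply: next_mean_subset_closed => // k kG j pj; rewrite eG'; apply: (stepG' k kG).2.
have [|j] := closed_classes_meet _ (p_unichain mu) cC cC' nC nC'.
  by move=> i j; exact: p_ge0.
rewrite !inE => /andP[/hG + /hG'].
have le1 : eta <= eta * c ^+ (size s).+1 by rewrite ler_peMr// exprn_ege1.
set V := lazy_run _ _ _ _; lra.
Qed.

(** If the oscillation failed to shrink, a maximal and a minimal coordinate would
    be two sets as in [scrambling_growth], and after [#|S * A|] steps they would
    have outgrown the index set. *)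
Lemma lazy_run_scrambling : exists2 eps : R, 0 < eps < 1 &
  forall s (D : Qs) b, size s = #|{: S * A}| ->
  (forall k l, D ord0 k - D ord0 l <= b) ->
  forall k l, lazy_run s D ord0 k - lazy_run s D ord0 l <= (1 - eps) * b.
Proof.
have [c c1 grow] := scrambling_growth.
(* eps * c ^+ m = 1 / 4 stays below the threshold 1 / 2. *)
pose m := #|{: S * A}|; pose eps := (4 * c ^+ m)^-1.
have cm1 : 1 <= c ^+ m by exact: exprn_ege1.
have eps0 : 0 < eps by rewrite invr_gt0; lra.
have epsc : eps * c ^+ m = 4^-1.
  by rewrite /eps; field; rewrite gt_eqF//; lra.
have eps1 : eps < 1.
  have : eps <= eps * c ^+ m by rewrite ler_peMr// ltW.
  by lra.
exists eps; first by rewrite eps0.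
move=> s D b ss oscD k l.
have b0 : 0 <= b by have := oscD k k; rewrite subrr.
pose lo := [arg min_(i < k) D ord0 i]%O.
have loP i : D ord0 lo <= D ord0 i by rewrite /lo; case: arg_minP => // j _; apply.
have hi i : D ord0 i <= D ord0 lo + b by have := oscD i lo; lra.
move: b0; rewrite le_eqVlt => /predU1P[b0|b0].
  have Dc i : D ord0 lo <= D ord0 i <= D ord0 lo by rewrite loP/=; have := hi i; lra.
  by rewrite -b0 mulr0; have := lazy_run_bounds s Dc k; have := lazy_run_bounds s Dc l; lra.
pose E : Qs := b^-1 *: D + (- b^-1 * D ord0 lo) *: const_mx 1.
have E01 i : 0 <= E ord0 i <= 1.
  rewrite !mxE mulr1 mulNr -mulrBr; apply/andP; split.
    by rewrite mulr_ge0 ?subr_ge0// invr_ge0 ltW.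
  by rewrite mulrC ler_pdivrMr// mul1r; have := hi i; lra.
have rE i : lazy_run s E ord0 i = b^-1 * (lazy_run s D ord0 i - D ord0 lo).
  by rewrite /E lazy_run_comb lazy_run_cst !mxE; ring.
rewrite leNgt; apply/negP => gt.
have gtE : 1 - eps < lazy_run s E ord0 k - lazy_run s E ord0 l.
  rewrite !rE -mulrBr mulrC ltr_pdivlMr//; lra.
have := lazy_run_bounds s E01 k; have := lazy_run_bounds s E01 l => rl rk.
have := grow s E eps [set k]%SET [set l]%SET E01 (ltW eps0).
rewrite ss epsc !cards1 -[X in (_ <= X)%N]add0n leq_add2r => H.
suff : (1 + 1 <= 0)%N by [].
apply: H; first by lra.
- by exists k; rewrite inE.
- by exists l; rewrite inE.
- by move=> x; rewrite inE => /eqP ->; lra.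
- by move=> x; rewrite inE => /eqP ->; lra.
Qed.

End Scrambling.

(** * A seminorm contracted by every lazy step *)

Section Seminorm.
Variables (R : realType) (S A : finType) (p : S -> A -> S -> R).
Hypothesis p_ge0 : forall i u j, 0 <= p i u j.
Hypothesis p_sum1 : forall i u, \sum_j p i u j = 1.
Hypothesis p_unichain : unichain p.
Variable lam : R.
Hypothesis lam_gt0 : 0 < lam.
Hypothesis lam_lt1 : lam < 1.

Notation Qs := (Qspace R S A).
Notation pol := (policy R S A).
Notation lazy_run := (lazy_run p lam).
Notation lazy_step := (lazy_step p lam).

Record lazy_contraction (N : Qs -> R) (rho C : R) : Prop := LazyContraction {
  lc_rho : 0 < rho < 1;
  lc_C : 0 < C;
  lc_osc : forall (D : Qs) k l, D ord0 k - D ord0 l <= N D;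
  lc_norm : forall D, N D <= C * `|D|;
  lc_add : forall D E, N (D + E) <= N D + N E;
  lc_scale : forall c D, 0 <= c -> N (c *: D) <= c * N D;
  lc_cst : forall c, N (const_mx c) <= 0;
  lc_opp : forall D, N (- D) <= N D;
  lc_lazy : forall (nu : pol) D, N (lazy_step nu D) <= rho * N D }.

(** The weights [rho ^- n] turn the contraction of the oscillation over
    [#|S * A|] steps into a contraction in every single step. *)
Theorem contracting_seminorm (i0 : S) (a0 : A) :
  exists N rho C, lazy_contraction N rho C.
Proof.
have [eps /andP[eps0 eps1] scr] := lazy_run_scrambling p_ge0 p_sum1 p_unichain lam_gt0 lam_lt1.
pose m := #|{: S * A}|; pose k0 : 'I_m := enum_rank (i0, a0).
have m0 : (0 < m)%N by exact: leq_ltn_trans (ltn_ord k0).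
have m0r : 0 < m%:R :> R by rewrite ltr0n.
pose rho := 1 - eps / (2 * m%:R).
have epsm : 0 < eps / (2 * m%:R) < 1.
  rewrite divr_gt0 ?mulr_gt0//= ltr_pdivrMr ?mulr_gt0// mul1r.
  by have : 1 <= m%:R :> R by [rewrite ler1n|]; lra.
have rho01 : 0 < rho < 1 by rewrite /rho; lra.
have rho0 : 0 < rho by case/andP: rho01.
have rhom : 1 - eps <= rho ^+ m.
  apply: le_trans (bernoulli_ineq m _ _); [|lra|lra].
  rewrite (_ : m%:R * _ = eps / 2); first lra.
  by field; rewrite gt_eqF.
pose W (D : Qs) := [set r | exists s k l, (size s < m)%N /\
  r = rho ^- size s * (lazy_run s D ord0 k - lazy_run s D ord0 l)].
pose N D := sup (W D).
have W0 D : W D !=set0.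
  by exists (rho ^- 0 * (D ord0 k0 - D ord0 k0)), [::], k0, k0.
have nD (D : Qs) k : - `|D| <= D ord0 k <= `|D|.
  rewrite -ler_norml; rewrite [leRHS]mx_normrE.
  exact: (le_bigmax _ (fun i : 'I_1 * 'I_m => `|D i.1 i.2|) (ord0, k)).
have rhoV n : 0 <= rho ^- n by rewrite invr_ge0 exprn_ge0// ltW.
have rhoW n : (n < m)%N -> rho ^- n <= rho ^- m.
  move=> nm; rewrite lef_pV2 ?posrE ?exprn_gt0//.
  by apply: ler_wiXn2l; [exact: ltW|lra|exact: ltnW].
have WC D r : W D r -> r <= (2 * rho ^- m) * `|D|.
  move=> [s [k [l [sm ->]]]].
  have b := lazy_run_bounds p_ge0 p_sum1 lam_gt0 lam_lt1 s (nD D); have := b k; have := b l => bl bk.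
  apply: (@le_trans _ _ (rho ^- size s * (2 * `|D|))).
    by apply: ler_wpM2l => //; lra.
  rewrite -mulrA mulrCA ler_wpM2l// ler_wpM2r//; exact: rhoW.
have Wub D : has_ubound (W D) by exists ((2 * rho ^- m) * `|D|) => r; exact: WC.
have leN (D : Qs) s k l : (size s < m)%N ->
    rho ^- size s * (lazy_run s D ord0 k - lazy_run s D ord0 l) <= N D.
  by move=> sm; apply: ub_le_sup => //; exists s, k, l.
have Nle (D : Qs) b : (forall s k l, (size s < m)%N ->
    rho ^- size s * (lazy_run s D ord0 k - lazy_run s D ord0 l) <= b) -> N D <= b.
  move=> h; apply: ge_sup => // r [s [k [l [sm ->]]]]; exact: h.
have oscN (D : Qs) k l : D ord0 k - D ord0 l <= N D.
  by have := leN D [::] k l m0; rewrite expr0 invr1 mul1r.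
have runN s D : lazy_run s (- D) = - lazy_run s D.
  have := lazy_run_comb p lam s (-1) 0 D 0; rewrite !scale0r !addr0 !scaleN1r.
  by [].
exists N, rho, (2 * rho ^- m); split=> //.
- by rewrite mulr_gt0// invr_gt0 exprn_gt0.
- by move=> D; apply: Nle => s k l sm; apply: WC; exists s, k, l.
- move=> D E; apply: Nle => s k l sm.
  apply: le_trans (lerD (leN D s k l sm) (leN E s k l sm)).
  have := lazy_run_comb p lam s 1 1 D E; rewrite !scale1r => ->.
  by rewrite -mulrDr ler_wpM2l// !mxE; lra.
- move=> c D c0; apply: Nle => s k l sm.
  apply: le_trans (ler_wpM2l c0 (leN D s k l sm)).
  have := lazy_run_comb p lam s c 0 D 0; rewrite !scale0r !addr0 => ->.
  by rewrite mulrCA ler_wpM2l// !mxE mulrBr.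
- move=> c; apply: Nle => s k l sm.
  by rewrite lazy_run_cst// !mxE subrr mulr0.
- move=> D; apply: Nle => s k l sm; apply: le_trans (leN D s l k sm).
  by rewrite ler_wpM2l// runN !mxE; lra.
- move=> nu D; apply: Nle => s k l sm.
  have N0 : 0 <= N D by have := oscN D k0 k0; rewrite subrr.
  have [sm1|sm1] := ltnP (size s).+1 m.
    have := ler_wpM2l (ltW rho0) (leN D (nu :: s) k l sm1); apply: le_trans.
    by rewrite /= exprS invfM mulrA mulVKf ?gt_eqF.
  have ssm : size (nu :: s) = m by apply/eqP; rewrite eqn_leq sm1/= sm.
  have := scr (nu :: s) D (N D) ssm (oscN D) k l => /= H.
  rewrite -(ler_pM2l (exprn_gt0 (size s) rho0)) mulVKf; last first.
    by rewrite gt_eqF// exprn_gt0.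
  apply: (le_trans H); rewrite mulrA ler_wpM2r// -exprSr.
  by apply: (le_trans rhom); rewrite -ssm.
Qed.

End Seminorm.

(** * The Bellman operator *)

Section RowNorm.
Variables (R : realType) (m : nat).
Implicit Types D E : 'rV[R]_m.

Lemma row_coord_le_norm D k : `|D ord0 k| <= `|D|.
Proof.
rewrite [leRHS]mx_normrE.
exact: (le_bigmax _ (fun i : 'I_1 * 'I_m => `|D i.1 i.2|) (ord0, k)).
Qed.

Lemma row_norm_le D b : 0 <= b -> (forall k, `|D ord0 k| <= b) -> `|D| <= b.
Proof.
move=> b0 Db; rewrite [leLHS]mx_normrE; apply/bigmax_leP; split=> //= -[i k] _ /=.
by rewrite (ord1 i).
Qed.

End RowNorm.

Section FiniteMax.
Variables (R : realType) (T : finType) (x0 : T).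
Implicit Types F : T -> R.

Lemma sum_indicator_eq (a : T) F : \sum_x (x == a)%:R * F x = F a.
Proof.
rewrite (bigD1 a)//= eqxx mul1r big1 ?addr0// => x /negbTE ->.
by rewrite mul0r.
Qed.

Lemma fmax_ge F x : F x <= fmax x0 F.
Proof. exact: le_bigmax. Qed.

Lemma fmax_attained F : exists x, fmax x0 F = F x.
Proof.
have [x _ xP] := @arg_maxP _ _ T x0 xpredT F isT.
exists x; apply/le_anti; rewrite fmax_ge andbT.
by apply/bigmax_leP; split => [|y _]; exact: xP.
Qed.

Lemma fmax_le F b : (forall x, F x <= b) -> fmax x0 F <= b.
Proof. by move=> Fb; have [x ->] := fmax_attained F. Qed.

(** The difference lies between [F - G] at a maximiser of [G] and [F - G] at a
    maximiser of [F]. *)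
Lemma fmax_diff F G : exists w : T -> R,
  [/\ forall x, 0 <= w x, \sum_x w x = 1
    & fmax x0 F - fmax x0 G = \sum_x w x * (F x - G x)].
Proof.
have [a aE] := fmax_attained F; have [b bE] := fmax_attained G.
pose e := fmax x0 F - fmax x0 G.
pose ua := F a - G a; pose ub := F b - G b.
have e1 : e <= ua by rewrite /e /ua aE lerB// fmax_ge.
have e2 : ub <= e by rewrite /e /ub bE lerB// fmax_ge.
have [t /andP[t0 t1] te] : exists2 t, 0 <= t <= 1 & e = t * ua + (1 - t) * ub.
  have [uab|uab] := eqVneq ua ub.
    exists 0; rewrite ?lexx ?ler01// mul0r add0r subr0 mul1r.
    by apply/le_anti; rewrite e2 -uab e1.
  have d0 : 0 < ua - ub by rewrite subr_gt0 lt_neqAle eq_sym uab (le_trans e2).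
  exists ((e - ub) / (ua - ub)).
    rewrite divr_ge0 ?subr_ge0//=; last by rewrite -subr_ge0 ltW.
    by rewrite ler_pdivrMr// mul1r lerB.
  by field; rewrite gt_eqF.
exists (fun x => t * (x == a)%:R + (1 - t) * (x == b)%:R); split.
- by move=> x; rewrite addr_ge0// mulr_ge0 ?subr_ge0.
- under eq_bigr do rewrite -[(_ == a)%:R]mulr1 -[(_ == b)%:R]mulr1.
  by rewrite big_split/= -!mulr_sumr !sum_indicator_eq !mulr1 subrKC.
- rewrite -/e te; under eq_bigr do rewrite mulrDl -!mulrA.
  by rewrite big_split/= -!mulr_sumr !sum_indicator_eq.
Qed.

End FiniteMax.

Section Bellman.
Variables (R : realType) (S A : finType) (a0 : A) (p g : S -> A -> S -> R).
Hypothesis p_ge0 : forall i u j, 0 <= p i u j.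
Hypothesis p_sum1 : forall i u, \sum_j p i u j = 1.

Notation Qs := (Qspace R S A).
Notation pol := (policy R S A).
Notation H := (bellmanH a0 p g).
Notation e := (const_mx 1 : Qs).

Definition vmax (Q : Qs) (j : S) : R := fmax a0 (fun u => qval Q j u).

Definition reward (i : S) (u : A) : R := \sum_j p i u j * g i u j.

Lemma bellmanE r Q : H r Q = mkQ reward + next_mean p (vmax Q) - r *: e.
Proof.
apply/rowP => k; rewrite !mxE mulr1 -big_split/=.
by congr (_ - _); apply: eq_bigr => j _; rewrite mulrDr.
Qed.

Lemma bellmanBr r Q : H r Q = H 0 Q - r *: e.
Proof. by rewrite !bellmanE scale0r subr0. Qed.

Lemma vmax_shift (Q : Qs) c j : vmax (Q + c *: e) j = vmax Q j + c.
Proof.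
apply/le_anti/andP; split.
  apply: fmax_le => u; rewrite /qval !mxE mulr1 lerD2r.
  exact: (fmax_ge a0 (fun u => qval Q j u)).
have [u uE] := fmax_attained a0 (fun u => qval Q j u).
rewrite /vmax uE.
apply: le_trans (fmax_ge a0 (fun u => qval (Q + c *: e) j u) u).
by rewrite /qval !mxE mulr1.
Qed.

Lemma bellman_shift r (Q : Qs) c : H r (Q + c *: e) = H r Q + c *: e.
Proof.
rewrite !bellmanE (_ : vmax _ = fun j => 1 * vmax Q j + c * 1); last first.
  by apply/funext => j; rewrite vmax_shift mul1r mulr1.
rewrite (next_mean_comb p) scale1r next_mean_cst//.
by apply/rowP => k; rewrite !mxE; ring.
Qed.

(** Linearises the maximisation: on a given pair of arguments the operator acts
    on the difference like one step of a randomised policy. *)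
Lemma bellman_diff r (Q Q' : Qs) : exists nu : pol,
  H r Q - H r Q' = next_mean p (pol_avg nu (Q - Q')).
Proof.
have [w wP] := choice (fun j => fmax_diff a0 (fun u => qval Q j u) (fun u => qval Q' j u)).
have w0 j u : 0 <= w j u by have [] := wP j.
have w1 j : \sum_u w j u = 1 by have [] := wP j.
exists (Policy w0 w1).
rewrite !bellmanE (_ : pol_avg _ _ = fun j => 1 * vmax Q j + (-1) * vmax Q' j).
  by rewrite (next_mean_comb p); apply/rowP => k; rewrite !mxE; ring.
apply/funext => j; have [_ _] := wP j.
rewrite mul1r mulN1r => ->; apply: eq_bigr => u _.
by rewrite /qval !mxE.
Qed.

Lemma next_mean_avg_norm (nu : pol) (D : Qs) : `|next_mean p (pol_avg nu D)| <= `|D|.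
Proof.
have nD (k : 'I_#|{: S * A}|) : - `|D| <= D ord0 k <= `|D|.
  by rewrite -ler_norml row_coord_le_norm.
apply: row_norm_le => // k; rewrite ler_norml.
have cstE c : next_mean p (pol_avg nu (const_mx c)) ord0 k = c.
  rewrite (_ : pol_avg nu _ = fun=> c) ?next_mean_cst// ?mxE//.
  by apply/funext => j; exact: pol_avg_cst.
apply/andP; split.
  rewrite -[leLHS]cstE; apply: next_mean_mono => // j; apply: pol_avg_mono => l.
  by rewrite mxE; case/andP: (nD l).
rewrite -[leRHS]cstE; apply: next_mean_mono => // j; apply: pol_avg_mono => l.
by rewrite mxE; case/andP: (nD l).
Qed.

Lemma bellman_nonexpansive r (Q Q' : Qs) : `|H r Q - H r Q'| <= `|Q - Q'|.
Proof. by have [nu ->] := bellman_diff r Q Q'; exact: next_mean_avg_norm. Qed.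

Section Seminorm.
Variables (lam : R) (N : Qs -> R) (rho C : R).
Hypothesis lam_gt0 : 0 < lam.
Hypothesis NP : lazy_contraction p lam N rho C.
Variable k0 : 'I_#|{: S * A}|.

Lemma seminorm_ge0 (D : Qs) : 0 <= N D.
Proof. by have := lc_osc NP D k0 k0; rewrite subrr. Qed.

Lemma seminorm_shift (D : Qs) c : N (D + c *: e) = N D.
Proof.
have nc b : N (b *: e) <= 0.
  have -> : b *: e = const_mx b by apply/rowP => k; rewrite !mxE mulr1.
  exact: (lc_cst NP).
have h E b : N (E + b *: e) <= N E.
  by apply: le_trans (lc_add NP E (b *: e)) _; rewrite gerDl.
apply/le_anti; rewrite h/= -{1}(addrK (c *: e) D) -scaleNr; exact: h.
Qed.

Lemma normalised_le_seminorm (D : Qs) : `|D - D ord0 k0 *: e| <= N D.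
Proof.
apply: row_norm_le; first exact: seminorm_ge0.
move=> k; rewrite !mxE mulr1 ler_norml lerNl opprB.
by rewrite !(lc_osc NP).
Qed.

(** For [al <= lam] the averaged step is a convex combination of the identity
    and of a lazy step. *)
Lemma averaged_step_contraction r al (Q Q' : Qs) : 0 <= al <= lam ->
  N ((1 - al) *: (Q - Q') + al *: (H r Q - H r Q')) <=
  (1 - al * ((1 - rho) / lam)) * N (Q - Q').
Proof.
move=> /andP[al0 allam]; have [nu ->] := bellman_diff r Q Q'.
set D := Q - Q'; set T := next_mean p _.
pose t := al / lam.
have t0 : 0 <= t by rewrite divr_ge0// ltW.
have t1 : 0 <= 1 - t by rewrite subr_ge0 ler_pdivrMr// mul1r.
have -> : (1 - al) *: D + al *: T = (1 - t) *: D + t *: lazy_step p lam nu D.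
  rewrite /lazy_step -/T; apply/rowP => k; rewrite !mxE /t; field.
  by rewrite gt_eqF.
apply: le_trans (lc_add NP _ _) _.
apply: le_trans (lerD (lc_scale NP _ t1) (lc_scale NP _ t0)) _.
have := ler_wpM2l t0 (lc_lazy NP nu D).
have -> : al * ((1 - rho) / lam) = t * (1 - rho) by rewrite /t mulrA mulrAC.
by lra.
Qed.

End Seminorm.

End Bellman.

(** * Mean rewards over trajectories *)

Section Liminf.
Variable R : realType.
Implicit Types (u : R^nat) (r K : R).

Lemma limn_inf_le_rate u r K : (forall n, 0 <= u n) ->
  (forall n, (0 < n)%N -> u n <= r + K / n%:R) -> limn_inf u <= r.
Proof.
move=> u0 ur.
have lb m : has_lbound (sdrop u m) by exists 0 => _ [n _ <-].
have ndi : nondecreasing_seq (infs u).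
  by apply: nondecreasing_infs; exists 0 => _ [n _ <-].
have infsr m : infs u m <= r.
  apply/ler_addgt0Pr => e e0.
  have [n nK] : exists n, (`|K| / e) < n%:R.
    by exists (Num.bound (`|K| / e)); apply: archi_boundP; rewrite divr_ge0// ltW.
  pose k := maxn m n.+1.
  have k0 : (0 < k)%N by rewrite leq_max orbT.
  apply: (@le_trans _ _ (u k)).
    by apply: ge_inf => //; exists k => //=; rewrite leq_maxl.
  apply: (le_trans (ur _ k0)); rewrite lerD2l.
  rewrite ler_pdivrMr ?ltr0n// mulrC -ler_pdivrMr//.
  apply: (@le_trans _ _ (`|K| / e)); first by rewrite ler_pM2r ?invr_gt0// ler_norm.
  by rewrite (le_trans (ltW nK))// ler_nat leq_max leqnSn orbT.
apply: limr_le; last by apply: nearW.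
by apply: nondecreasing_is_cvgn => //; exists r => _ [n _ <-].
Qed.

Lemma limn_inf_eq_rate u r K :
  (forall n, (0 < n)%N -> `|u n - r| <= K / n%:R) -> limn_inf u = r.
Proof.
move=> ur; suff /cvg_limn_inf_sup[-> //] : u @ \oo --> r.
apply/cvgrPdist_le => e e0.
have [n nK] : exists n, (`|K| / e) < n%:R.
  by exists (Num.bound (`|K| / e)); apply: archi_boundP; rewrite divr_ge0// ltW.
exists n.+1 => // k /= nk; rewrite distrC.
have k0 : (0 < k)%N by exact: leq_trans nk.
apply: (le_trans (ur _ k0)).
rewrite ler_pdivrMr ?ltr0n// mulrC -ler_pdivrMr//.
apply: (@le_trans _ _ (`|K| / e)); first by rewrite ler_pM2r ?invr_gt0// ler_norm.
by rewrite (le_trans (ltW nK))// ler_nat ltnW.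
Qed.

End Liminf.

Section MeanReward.
Variables (R : realType) (S A : finType) (p g : S -> A -> S -> R).
Hypothesis p_sum1 : forall i u, \sum_j p i u j = 1.
Variable mu : {ffun S -> A}.

Fixpoint total_reward (n : nat) (i : S) : R :=
  if n is m.+1 then \sum_j p i (mu i) j * (g i (mu i) j + total_reward m j)
  else 0.

Definition ffun_cons n (s : S) (w : {ffun 'I_n.+1 -> S}) : {ffun 'I_n.+2 -> S} :=
  [ffun t => if unlift ord0 t is Some t' then w t' else s].

Lemma ffun_cons0 n s (w : {ffun 'I_n.+1 -> S}) : ffun_cons s w ord0 = s.
Proof. by rewrite ffunE unlift_none. Qed.

Lemma ffun_consS n s (w : {ffun 'I_n.+1 -> S}) t :
  ffun_cons s w (lift ord0 t) = w t.
Proof. by rewrite ffunE liftK. Qed.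

Lemma ffun_cons_inord n s (w : {ffun 'I_n.+1 -> S}) t : (t < n.+1)%N ->
  ffun_cons s w (inord t.+1) = w (inord t).
Proof.
move=> tn; have -> : inord t.+1 = lift ord0 (inord t) :> 'I_n.+2.
  by apply/ord_inj; rewrite lift0 !inordK.
exact: ffun_consS.
Qed.

Lemma sum_ffun_cons n (F : {ffun 'I_n.+2 -> S} -> R) :
  \sum_w F w = \sum_s \sum_w F (ffun_cons s w).
Proof.
rewrite pair_big/= (reindex (fun sw => ffun_cons sw.1 sw.2))//=.
exists (fun w => (w ord0, [ffun t => w (lift ord0 t)])) => [[s w] _|w _] /=.
  congr (_, _); first exact: ffun_cons0.
  by apply/ffunP => t; rewrite ffunE ffun_consS.
apply/ffunP => t; rewrite ffunE; case: unliftP => [t' ->|-> //].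
by rewrite ffunE.
Qed.

(** Markov property at the first step. In the sum over [j] only the initial
    state of [w] contributes, by the indicator in [traj_prob]. *)
Lemma traj_prob_cons i n s (w : {ffun 'I_n.+1 -> S}) :
  traj_prob p mu i (ffun_cons s w) =
  (s == i)%:R * \sum_j p i (mu i) j * traj_prob p mu j w.
Proof.
rewrite /traj_prob ffun_cons0 big_ord_recl.
have -> : inord 0 = ord0 :> 'I_n.+2 by apply/val_inj; rewrite /= inordK.
rewrite (ffun_cons_inord s w (ltn0Sn n)) ffun_cons0.
have -> : inord 0 = ord0 :> 'I_n.+1 by apply/val_inj; rewrite /= inordK.
have [-> |_] := eqVneq s i; last by rewrite !mul0r.
rewrite !mul1r [RHS](bigD1 (w ord0))//= eqxx mul1r [X in _ = _ + X]big1 ?addr0.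
  congr (_ * _); apply: eq_bigr => t _.
  by rewrite /= /bump leq0n add1n !ffun_cons_inord ?ltnS ?ltn_ord ?(ltnW (ltn_ord t)).
by move=> j; rewrite eq_sym => /negbTE ->; rewrite mul0r mulr0.
Qed.

Definition traj_reward n (w : {ffun 'I_n.+1 -> S}) : R :=
  \sum_(t < n) g (w (inord t)) (mu (w (inord t))) (w (inord t.+1)).

Lemma traj_reward_cons n s (w : {ffun 'I_n.+1 -> S}) :
  traj_reward (ffun_cons s w) = g s (mu s) (w ord0) + traj_reward w.
Proof.
rewrite /traj_reward big_ord_recl.
have -> : inord 0 = ord0 :> 'I_n.+2 by apply/val_inj; rewrite /= inordK.
rewrite (ffun_cons_inord s w (ltn0Sn n)) ffun_cons0.
have -> : inord 0 = ord0 :> 'I_n.+1 by apply/val_inj; rewrite /= inordK.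
congr (_ + _); apply: eq_bigr => t _.
by rewrite /= /bump leq0n add1n !ffun_cons_inord ?ltnS ?ltn_ord ?(ltnW (ltn_ord t)).
Qed.

Lemma sum_head_ffun (i : S) n (F : S -> {ffun 'I_n.+1 -> S} -> R) :
  \sum_s \sum_w (s == i)%:R * F s w = \sum_w F i w.
Proof.
rewrite (bigD1 i)//= [X in _ + X]big1 ?addr0.
  by apply: eq_bigr => w _; rewrite eqxx mul1r.
by move=> s /negbTE ->; rewrite big1// => w _; rewrite mul0r.
Qed.

Lemma traj_prob_sum1 i n : \sum_(w : {ffun 'I_n.+1 -> S}) traj_prob p mu i w = 1.
Proof.
elim: n i => [|n IH] i.
  rewrite (bigD1 [ffun=> i])//= /traj_prob big_ord0 mulr1 ffunE eqxx.
  rewrite big1 ?addr0// => w wi; rewrite big_ord0 mulr1.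
  case: eqP => // wi0; case/eqP: wi; apply/ffunP => t.
  by rewrite ffunE (ord1 t).
rewrite sum_ffun_cons.
under eq_bigr do under eq_bigr do rewrite traj_prob_cons.
rewrite sum_head_ffun exchange_big/= -[RHS](p_sum1 i (mu i)).
by apply: eq_bigr => j _; rewrite -mulr_sumr IH mulr1.
Qed.

Lemma traj_prob_reward i n :
  \sum_(w : {ffun 'I_n.+1 -> S}) traj_prob p mu i w * traj_reward w =
  total_reward n i.
Proof.
elim: n i => [|n IH] i.
  by rewrite big1// => w _; rewrite /traj_reward big_ord0 mulr0.
rewrite sum_ffun_cons.
under eq_bigr do under eq_bigr do rewrite traj_prob_cons -mulrA traj_reward_cons.
rewrite sum_head_ffun.
under eq_bigr do rewrite mulr_suml.
rewrite exchange_big/=; apply: eq_bigr => j _.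
rewrite -IH -[g i _ j]mulr1 -(traj_prob_sum1 j n) mulr_sumr -big_split/= mulr_sumr.
apply: eq_bigr => w _; rewrite -mulrA; congr (_ * _).
rewrite /traj_prob; have [->|_] := eqVneq (w ord0) j; first by ring.
by rewrite !mul0r mulr0 addr0.
Qed.

Lemma mean_rewardE i n : mean_reward p g mu i n = n%:R^-1 * total_reward n i.
Proof.
rewrite -traj_prob_reward /mean_reward mulr_sumr.
by apply: eq_bigr => w _; rewrite mulrCA.
Qed.

End MeanReward.

(** * Solution of the Bellman equation *)

Section OptimalReward.
Variables (R : realType) (S A : finType) (a0 : A) (p g : S -> A -> S -> R).
Hypothesis p_ge0 : forall i u j, 0 <= p i u j.
Hypothesis p_sum1 : forall i u, \sum_j p i u j = 1.
Hypothesis g_ge0 : forall i u j, 0 <= g i u j.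

Notation Qs := (Qspace R S A).
Notation H := (bellmanH a0 p g).
Notation vmax := (vmax a0).

Lemma vmax_norm (Q : Qs) j : - `|Q| <= vmax Q j <= `|Q|.
Proof.
have [u uE] := fmax_attained a0 (fun u => qval Q j u).
by rewrite /vmax uE -ler_norml; exact: row_coord_le_norm.
Qed.

Lemma total_reward_ge0 mu n i : 0 <= total_reward p g mu n i.
Proof.
elim: n i => [|n IH] i //=.
by apply: sumr_ge0 => j _; rewrite mulr_ge0 ?addr_ge0.
Qed.

Variables (r : R) (h : Qs).
Hypothesis hfix : H r h = h.

Lemma bellman_fixed_value i u :
  \sum_j p i u j * (g i u j + vmax h j) = qval h i u + r.
Proof. by rewrite -{2}hfix /qval mxE enum_rankK/= subrK. Qed.

Lemma total_reward_le mu n i :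
  total_reward p g mu n i <= n%:R * r + vmax h i + `|h|.
Proof.
elim: n i => [|n IH] i /=.
  by rewrite mul0r add0r; have /andP[] := vmax_norm h i; lra.
apply: (@le_trans _ _ (\sum_j (p i (mu i) j * (g i (mu i) j + vmax h j) +
    p i (mu i) j * (n%:R * r + `|h|)))).
  apply: ler_sum => j _; rewrite -mulrDr ler_wpM2l//.
  by have := IH j; lra.
rewrite big_split/= -mulr_suml p_sum1 mul1r bellman_fixed_value.
have := fmax_ge a0 (fun u => qval h i u) (mu i).
by rewrite -/(vmax h i) -natr1; lra.
Qed.

Lemma total_reward_greedy : exists mu : {ffun S -> A}, forall n i,
  n%:R * r + vmax h i - `|h| <= total_reward p g mu n i.
Proof.
have [m mE] := choice (fun i => fmax_attained a0 (fun u => qval h i u)).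
exists [ffun i => m i]; elim=> [|n IH] i /=.
  by rewrite mul0r add0r; have /andP[] := vmax_norm h i; lra.
rewrite ffunE.
apply: (@le_trans _ _ (\sum_j (p i (m i) j * (g i (m i) j + vmax h j) +
    p i (m i) j * (n%:R * r - `|h|)))); last first.
  apply: ler_sum => j _; rewrite -mulrDr ler_wpM2l//.
  by have := IH j; lra.
rewrite big_split/= -mulr_suml p_sum1 mul1r bellman_fixed_value.
by rewrite -mE -/(vmax h i) -natr1; lra.
Qed.

(** Verification: the relative values bound the total reward of every policy
    by [n * r] up to a constant, and the greedy policy attains it. *)
Lemma opt_reward_fixed i0 : opt_reward a0 p g i0 = r.
Proof.
have h0 := normr_ge0 h.
have le mu n : (0 < n)%N ->
    mean_reward p g mu i0 n <= r + (2 * `|h|) / n%:R.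
  move=> n0; have n0r : 0 < n%:R :> R by rewrite ltr0n.
  rewrite mean_rewardE// ler_pdivrMl// mulrDr [_ * (_ / _)]mulrC divfK ?gt_eqF//.
  have /andP[_] := vmax_norm h i0; have := total_reward_le mu n i0.
  by lra.
apply/le_anti/andP; split.
  apply: fmax_le => mu; apply: (@limn_inf_le_rate _ _ _ (2 * `|h|)).
    by move=> n; rewrite mean_rewardE// mulr_ge0 ?invr_ge0// total_reward_ge0.
  exact: le.
have [mu muP] := total_reward_greedy.
rewrite /opt_reward; apply: le_trans (fmax_ge _ _ mu).
rewrite /avg_reward (@limn_inf_eq_rate _ _ r (2 * `|h|))// => n n0.
have n0r : 0 < n%:R :> R by rewrite ltr0n.
have := le mu n n0; rewrite ler_norml lerBlDl => ->; rewrite andbT.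
rewrite lerBrDl mean_rewardE// ler_pdivlMl// mulrBr [_ * (_ / _)]mulrC divfK ?gt_eqF//.
have /andP[+ _] := vmax_norm h i0; have := muP n i0.
by lra.
Qed.

End OptimalReward.

(* Joins the norm and the completeness of row vectors. *)
HB.instance Definition _ (R : realType) (n : nat) :=
  Complete.copy 'rV[R]_n 'rV[R]_n.

Section FixedPoint.
Variables (R : realType) (S A : finType) (a0 : A) (p g : S -> A -> S -> R).
Hypothesis p_ge0 : forall i u j, 0 <= p i u j.
Hypothesis p_sum1 : forall i u, \sum_j p i u j = 1.

Notation Qs := (Qspace R S A).
Notation H := (bellmanH a0 p g).
Notation e := (const_mx 1 : Qs).

Variables (lam : R) (N : Qs -> R) (rho C : R).
Hypothesis lam_gt0 : 0 < lam.
Hypothesis NP : lazy_contraction p lam N rho C.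
Variable k0 : 'I_#|{: S * A}|.

Let L (Q : Qs) : Qs := (1 - lam) *: Q + lam *: H 0 Q.

Let L_contraction (Q Q' : Qs) : N (L Q - L Q') <= rho * N (Q - Q').
Proof.
have lam1 : 0 <= lam <= lam by rewrite lexx ltW.
have := averaged_step_contraction a0 g lam_gt0 NP 0 Q Q' lam1.
rewrite [lam * _]mulrC divfK ?gt_eqF// subKr; apply: le_trans.
rewrite le_eqVlt; apply/orP; left; apply/eqP; congr N.
by apply/rowP => k; rewrite !mxE; ring.
Qed.

Lemma bellman_fixed_unique r (Q Q' : Qs) : H r Q = Q -> H r Q' = Q' ->
  Q - Q' = (Q - Q') ord0 k0 *: e.
Proof.
move=> hQ hQ'.
have /andP[rho0 rho1] := lc_rho NP.
have lam1 : 0 <= lam <= lam by rewrite lexx ltW.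
have := averaged_step_contraction a0 g lam_gt0 NP r Q Q' lam1.
rewrite hQ hQ' -scalerDl subrK scale1r [lam * _]mulrC divfK ?gt_eqF// subKr => le.
have N0 : N (Q - Q') <= 0.
  rewrite -(ler_pM2l (_ : 0 < 1 - rho)) ?subr_gt0// mulr0 mulrBl mul1r.
  by rewrite subr_le0.
apply/eqP; rewrite -subr_eq0 -normr_eq0 eq_le normr_ge0 andbT.
by apply: le_trans N0; exact: normalised_le_seminorm NP k0 _.
Qed.

(** The normalised iterates of the lazy Bellman operator form a Cauchy
    sequence; their limit is a fixed point up to a constant vector, which
    defines [r]. *)
Lemma bellman_fixed_exists : exists r Q, H r Q = Q.
Proof.
have /andP[rho0 rho1] := lc_rho NP.
have C0 := lc_C NP.
pose q n := iter n L 0.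
pose K := N (q 1%N - q 0%N).
have K0 : 0 <= K by exact: seminorm_ge0 NP k0 _.
have Nstep n : N (q n.+1 - q n) <= K * rho ^+ n.
  elim: n => [|n IH]; first by rewrite expr0 mulr1.
  apply: le_trans (L_contraction (q n.+1) (q n)) _.
  by rewrite exprS mulrCA ler_pM2l.
pose nrm (Q : Qs) : Qs := Q - Q ord0 k0 *: e.
pose qt n := nrm (q n).
have qtP n : `|qt n.+1 - qt n| <= K * rho ^+ n.
  apply: le_trans (Nstep n).
  have -> : qt n.+1 - qt n = nrm (q n.+1 - q n).
    by apply/rowP => k; rewrite !mxE; ring.
  exact: normalised_le_seminorm NP k0 _.
have cvg_qt : cvgn qt.
  have -> : qt = (fun n => qt 0%N + series (telescope qt) n).
    by apply/funext => n; exact: eq_sum_telescope.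
  apply: is_cvgD; first exact: is_cvg_cst.
  apply: normed_cvg.
  apply: (@series_le_cvg _ _ (geometric K rho)) => //.
  - by move=> n; exact: normr_ge0.
  - by move=> n; rewrite /geometric/= mulr_ge0// exprn_ge0// ltW.
  - by apply: is_cvg_geometric_series; rewrite ger0_norm// ltW.
pose h := limn qt.
have qth : qt @ \oo --> h by exact: cvg_qt.
have resid n : N (L h - h) <= 2 * (C * `|h - qt n|) + K * rho ^+ n.
  have e1 : N (h - q n) <= C * `|h - qt n|.
    apply: le_trans (lc_norm NP _).
    rewrite -(seminorm_shift NP (h - q n) (q n ord0 k0)).
    rewrite le_eqVlt; apply/orP; left; apply/eqP; congr N.
    by apply/rowP => k; rewrite !mxE; ring.
  have e2 : N (q n - h) <= C * `|h - qt n|.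
    by apply: le_trans e1; rewrite -opprB; exact: lc_opp NP _.
  have -> : L h - h = (L h - q n.+1) + ((q n.+1 - q n) + (q n - h)).
    by rewrite [(q n.+1 - _) + _]addrA subrK addrA subrK.
  apply: le_trans (lc_add NP _ _) _.
  have := lc_add NP (q n.+1 - q n) (q n - h).
  have e3 : N (L h - q n.+1) <= C * `|h - qt n|.
    apply: le_trans (L_contraction h (q n)) _.
    apply: le_trans e1; apply: ler_piMl; last exact: ltW.
    exact: seminorm_ge0 NP k0 _.
  by have := Nstep n; lra.
have N0 : N (L h - h) <= 0.
  have : (2 * (C * `|h - qt n|) + K * rho ^+ n) @[n --> \oo] --> 2 * (C * 0) + 0.
    apply: cvgD; last first.
      apply: (@cvg_geometric _ K rho); by rewrite ger0_norm// ltW.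
    apply: cvgMr; apply: cvgMr.
    apply/norm_cvg0P; rewrite -(subrr h); apply: cvgB; first exact: cvg_cst.
    exact: qth.
  rewrite mulr0 mulr0 addr0 => /cvgr_to_ge; apply; apply: nearW => n; exact: resid.
pose D : Qs := H 0 h - h.
exists (D ord0 k0), h.
have LD : L h - h = lam *: D by apply/rowP => k; rewrite !mxE; ring.
have D0 : nrm (lam *: D) = 0.
  apply/eqP; rewrite -normr_eq0 eq_le normr_ge0 andbT -LD.
  by apply: le_trans N0; exact: normalised_le_seminorm NP k0 _.
rewrite bellmanBr; apply/rowP => k.
move/rowP/(_ k)/eqP: D0; rewrite !mxE -mulrA -mulrBr mulf_eq0 gt_eqF//= => /eqP.
by rewrite !mulr1; lra.
Qed.

End FixedPoint.

(** * Sums of stepsizes *)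

Section PowerSums.
Variable R : realType.
Implicit Types (x eta : R) (k n : nat).

(** Multiply by [x `^ (- eta)] and bound [x `^ (1 - eta)] and [x `^ (- eta)] by
    the tangents of the exponential at 0: the linear terms cancel. *)
Lemma powR_bernoulli x eta : 0 < x -> 0 <= eta -> eta <= 1 ->
  x `^ eta <= 1 + eta * (x - 1).
Proof.
move=> x0 eta0 eta1; rewrite /powR gt_eqF//.
set y := ln x.
have xE : x = expR y by rewrite lnK.
rewrite {1}xE.
have h1 : 1 + (1 - eta) * y <= expR ((1 - eta) * y) by exact: expR_ge1Dx.
have h2 : 1 + - (eta * y) <= expR (- (eta * y)) by exact: expR_ge1Dx.
have E0 : 0 < expR (eta * y) by exact: expR_gt0.
have e1 : expR y = expR (eta * y) * expR ((1 - eta) * y).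
  by rewrite -expRD; congr expR; ring.
have e2 : expR (eta * y) * expR (- (eta * y)) = 1.
  by rewrite -expRD subrr expR0.
have : expR (eta * y) <=
    expR (eta * y) * (eta * expR ((1 - eta) * y) + (1 - eta) * expR (- (eta * y))).
  rewrite ler_peMr ?(ltW E0)//.
  have := ler_wpM2l eta0 h1.
  have e10 : 0 <= 1 - eta by rewrite subr_ge0.
  have := ler_wpM2l e10 h2.
  by lra.
rewrite mulrDr (mulrCA _ eta) -e1 (mulrCA _ (1 - eta)) e2.
by lra.
Qed.

(** Bounds a discrete derivative of a power, so that the two sums below
    telescope. *)
Lemma powR_succ_ratio k eta : (0 < k)%N -> 0 <= eta -> eta <= 1 ->
  k%:R `^ eta <= k.+1%:R `^ eta * (1 - eta / k.+1%:R).
Proof.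
move=> k0 eta0 eta1.
have k1 : 0 < k.+1%:R :> R by rewrite ltr0n.
have kE : k%:R = k.+1%:R * (k%:R / k.+1%:R) :> R.
  by rewrite mulrC divfK ?gt_eqF.
rewrite {1}kE powRM ?divr_ge0 ?ler0n// ler_wpM2l ?powR_ge0//.
apply: (le_trans (powR_bernoulli _ eta0 eta1)); first by rewrite divr_gt0 ?ltr0n.
rewrite le_eqVlt; apply/orP; left; apply/eqP.
by rewrite -[k.+1%:R]natr1; field; rewrite natr1 gt_eqF.
Qed.

Lemma sum_powR_le n eta : 0 < eta -> eta <= 1 ->
  \sum_(1 <= k < n.+1) (k.+1%:R : R) `^ (eta - 1) <= eta^-1 * n.+1%:R `^ eta.
Proof.
move=> eta0 eta1; rewrite -ler_pdivrMl ?invr_gt0// invrK mulr_sumr.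
elim: n => [|n IH]; first by rewrite big_geq// powR_ge0.
rewrite big_nat_recr//=.
have := powR_succ_ratio (ltn0Sn n) (ltW eta0) eta1.
have -> : (n.+2%:R : R) `^ (eta - 1) = n.+2%:R `^ eta / n.+2%:R.
  by rewrite powRB ?powRr1// pnatr_eq0 implybT.
rewrite mulrCA; move: IH.
set z := eta / _; set b := n.+2%:R `^ eta; set c := n.+1%:R `^ eta.
by set s := \sum_(_ <= _ < _) _; lra.
Qed.

Lemma sum_powR_summable n eta : 0 < eta -> eta <= 1 ->
  \sum_(1 <= k < n.+1) (k.+1%:R : R) `^ (- eta - 1) <= eta^-1.
Proof.
move=> eta0 eta1.
suff : eta * \sum_(1 <= k < n.+1) (k.+1%:R : R) `^ (- eta - 1) <=
    1 - (n.+1%:R `^ eta)^-1.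
  move=> h; rewrite -[eta^-1]mulr1 ler_pdivlMl//.
  by apply: le_trans h _; rewrite gerBl invr_ge0 powR_ge0.
rewrite mulr_sumr.
elim: n => [|n IH]; first by rewrite big_geq// powR1 invr1 subrr.
rewrite big_nat_recr//=; apply: le_trans (lerD IH (lexx _)) _.
have := powR_succ_ratio (ltn0Sn n) (ltW eta0) eta1.
have -> : (n.+2%:R : R) `^ (- eta - 1) = (n.+2%:R `^ eta)^-1 / n.+2%:R.
  by rewrite powRB ?powRr1 ?powRN// pnatr_eq0 implybT.
have a0 : 0 < n.+1%:R `^ eta :> R by rewrite powR_gt0 ?ltr0n.
have b0 : 0 < n.+2%:R `^ eta :> R by rewrite powR_gt0 ?ltr0n.
set a := n.+1%:R `^ eta in a0 *; set b := n.+2%:R `^ eta in b0 *.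
rewrite mulrCA; set z := eta / _ => h.
have z0 : 0 <= z by rewrite divr_ge0 ?ltW ?ltr0n.
suff : b^-1 * (1 + z) <= a^-1 by lra.
rewrite ler_pdivrMl// ler_pdivlMr//.
apply: (@le_trans _ _ ((1 + z) * (b * (1 - z)))).
  by rewrite ler_wpM2l//; lra.
have : 0 <= b * (z * z) by rewrite !mulr_ge0// ltW.
by lra.
Qed.

End PowerSums.

Section Stepsizes.
Variables (R : realType) (a : R).
Hypothesis a_gt : 4%:R / 5%:R < a.
Hypothesis a_le1 : a <= 1.
Notation alpha := (stepsize a).

Let n1 n : 1 <= n.+1%:R :> R. Proof. by rewrite ler1n. Qed.
Let n0 n : 0 < n.+1%:R :> R. Proof. by rewrite ltr0n. Qed.

Let a_gt0 : 0 < a.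
Proof. by apply: lt_trans a_gt; rewrite divr_gt0 ?ltr0n. Qed.

Lemma stepsizeE n : alpha n = n.+1%:R `^ (- a).
Proof. by rewrite /stepsize powRN div1r. Qed.

Lemma stepsize_gt0 n : 0 < alpha n.
Proof. by rewrite stepsizeE powR_gt0. Qed.

Lemma stepsize_ge n : (n.+1%:R)^-1 <= alpha n.
Proof. by rewrite stepsizeE -powR_inv1// ler_powR// lerN2. Qed.

Lemma stepsize_le n : alpha n <= n.+1%:R `^ (- (4%:R / 5%:R)).
Proof. by rewrite stepsizeE ler_powR// lerN2 ltW. Qed.

Lemma stepsize1_lt1 : alpha 1%N < 1.
Proof.
rewrite stepsizeE powRN invf_lt1 ?powR_gt0//.
by rewrite /powR gt_eqF// expR_gt1 mulr_gt0// ln_gt0// ltr1n.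
Qed.

Lemma stepsize_le1 n : (0 < n)%N -> alpha n <= alpha 1%N.
Proof.
move=> n_gt0; rewrite !stepsizeE !powRN lef_pV2 ?posrE ?powR_gt0//.
by apply: ge0_ler_powR; rewrite ?nnegrE// ?ler_nat// ltW.
Qed.

Lemma stepsize_bounds n : (0 < n)%N -> 0 <= alpha n <= alpha 1%N.
Proof. by move=> n_gt0; rewrite stepsize_le1// ltW ?stepsize_gt0. Qed.

Lemma tau_recr n : tau alpha n.+1 =
  tau alpha n + alpha n.+1 * (1 - alpha n.+1).
Proof. by rewrite /tau big_nat_recr. Qed.

Lemma tau0 : tau alpha 0 = 0.
Proof. by rewrite /tau big_geq. Qed.

Lemma tau_ge0 n : 0 <= tau alpha n.
Proof.
rewrite /tau big_nat_cond; apply: sumr_ge0 => k /andP[/andP[k0 _] _].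
rewrite mulr_ge0 ?(ltW (stepsize_gt0 _))// subr_ge0.
exact: le_trans (stepsize_le1 k0) (ltW stepsize1_lt1).
Qed.

Lemma tau_le n : tau alpha n <= 5%:R * n.+1%:R `^ (5%:R^-1).
Proof.
have h := @sum_powR_le R n 5%:R^-1 _ _.
rewrite invrK in h; apply: le_trans (h _ _); [|lra|lra].
rewrite /tau big_nat_cond [leRHS]big_nat_cond.
apply: ler_sum => k /andP[/andP[k0 _] _].
have -> : 5%:R^-1 - 1 = - (4%:R / 5%:R) :> R by field.
apply: le_trans (stepsize_le k); rewrite ler_piMr ?(ltW (stepsize_gt0 _))//.
by rewrite gerBl ltW ?stepsize_gt0.
Qed.

Lemma stepsize_sqr_le n : alpha n ^+ 2 <= n.+1%:R `^ (- (8%:R / 5%:R)).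
Proof.
have -> : - (8%:R / 5%:R) = - (4%:R / 5%:R) + - (4%:R / 5%:R) :> R by field.
rewrite powRD; last by rewrite (gt_eqF (n0 n)) implybT.
by rewrite expr2 ler_pM ?(ltW (stepsize_gt0 _))// stepsize_le.
Qed.

Lemma sum_stepsize_sqr n : \sum_(1 <= k < n.+1) alpha k ^+ 2 <= 5%:R / 2%:R.
Proof.
have h := @sum_powR_summable R n (2%:R / 5%:R) _ _.
rewrite invf_div in h; apply: le_trans (h _ _); [|lra|lra].
apply: ler_sum => k _; apply: le_trans (stepsize_sqr_le k) _.
by rewrite ler_powR//; lra.
Qed.

(** The terms are at most of order [k `^ (1 / 5 - 8 / 5)]. *)
Lemma sum_stepsize_sqr_tau n :
  \sum_(1 <= k < n.+1) alpha k ^+ 2 * tau alpha k <= 25%:R / 2%:R.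
Proof.
have h := @sum_powR_summable R n (2%:R / 5%:R) _ _.
rewrite invf_div in h.
have -> : 25%:R / 2%:R = 5%:R * (5%:R / 2%:R) :> R by field.
apply: (@le_trans _ _
  (5%:R * \sum_(1 <= k < n.+1) k.+1%:R `^ (- (2%:R / 5%:R) - 1))); last first.
  by rewrite ler_wpM2l// h//; lra.
rewrite mulr_sumr; apply: ler_sum => k _.
apply: le_trans (ler_pM _ _ (stepsize_sqr_le k) (tau_le k)) _.
- by rewrite exprn_ge0 ?(ltW (stepsize_gt0 _)).
- exact: tau_ge0.
rewrite mulrCA -powRD; last by rewrite (gt_eqF (n0 k)) implybT.
by rewrite ler_wpM2l// ler_powR//; lra.
Qed.

Lemma sum_stepsize_sqr_lin n :
  \sum_(1 <= k < n.+1) alpha k ^+ 2 * k.+1%:R <=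
  5%:R / 2%:R * n.+1%:R `^ (2%:R / 5%:R).
Proof.
have h := @sum_powR_le R n (2%:R / 5%:R) _ _.
rewrite invf_div in h; apply: le_trans (h _ _); [|lra|lra].
apply: ler_sum => k _.
apply: le_trans (ler_pM _ _ (stepsize_sqr_le k) (lexx _)) _ => //.
  by rewrite exprn_ge0 ?(ltW (stepsize_gt0 _)).
rewrite -{2}[k.+1%:R]powRr1// -powRD; last by rewrite (gt_eqF (n0 k)) implybT.
by rewrite ler_powR//; lra.
Qed.

Lemma ln_le_sum_stepsize n :
  ln n.+2%:R - ln 2%:R <= \sum_(1 <= k < n.+1) alpha k.
Proof.
elim: n => [|n IH]; first by rewrite big_geq// subrr.
rewrite big_nat_recr//=; apply: le_trans (lerD IH (stepsize_ge n.+1)).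
suff : ln n.+3%:R - ln n.+2%:R <= n.+2%:R^-1 :> R.
  by set x := ln n.+3%:R; set y := ln n.+2%:R; set z := _^-1; lra.
rewrite -ln_div ?posrE//.
have -> : n.+3%:R / n.+2%:R = 1 + n.+2%:R^-1 :> R.
  by rewrite -[n.+3%:R]natr1 mulrDl divff ?mul1r// gt_eqF.
by apply: le_ln1Dx; apply: lt_trans (_ : 0 < _); rewrite ?invr_gt0// ltrN10.
Qed.

Lemma sum_stepsize_unbounded M : exists n, M <= \sum_(1 <= k < n.+1) alpha k.
Proof.
exists (Num.bound (expR (M + ln 2%:R))).
apply: le_trans (ln_le_sum_stepsize _); rewrite lerBrDr.
rewrite -ler_expR lnK ?posrE//.
apply: le_trans (ltW (archi_boundP (expR_ge0 _))) _.
by rewrite ler_nat; do 2!apply: leqW.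
Qed.

Lemma tau_ge_sum n :
  (1 - alpha 1%N) * \sum_(1 <= k < n.+1) alpha k <= tau alpha n.
Proof.
rewrite mulr_sumr /tau big_nat_cond [leRHS]big_nat_cond.
apply: ler_sum => k /andP[/andP[k0 _] _].
by rewrite mulrC ler_pM2l ?stepsize_gt0// lerB// stepsize_le1.
Qed.

End Stepsizes.

(** * Scalar recursions *)

Section Recursions.
Variable R : realType.
Implicit Types (W B x : nat -> R) (alpha : nat -> R).

Lemma gronwall_bound W alpha C M :
  0 <= C -> (forall n, 0 <= W n) ->
  (forall n, W n.+1 <= (1 + C * alpha n.+1 ^+ 2) * W n + C * alpha n.+1 ^+ 2) ->
  (forall n, \sum_(1 <= k < n.+1) alpha k ^+ 2 <= M) ->
  forall n, W n <= expR (C * M) * (1 + W 0%N).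
Proof.
move=> C0 W0 Wrec sM n.
have h : 1 + W n <= expR (C * \sum_(1 <= k < n.+1) alpha k ^+ 2) * (1 + W 0%N).
  elim: n => [|n IH]; first by rewrite big_geq// mulr0 expR0 mul1r.
  rewrite big_nat_recr//= [C * (_ + _)]mulrDr expRD.
  set E := expR _ in IH *; set t := C * _.
  have t0 : 0 <= t by rewrite mulr_ge0// sqr_ge0.
  apply: (@le_trans _ _ ((1 + t) * (1 + W n))).
    by have := Wrec n; rewrite -/t; lra.
  apply: (@le_trans _ _ (expR t * (E * (1 + W 0%N)))).
    apply: ler_pM => //; [lra|by have := W0 n; lra|exact: expR_ge1Dx].
  by rewrite mulrA [E * _]mulrC.
have E1 : expR (C * \sum_(1 <= k < n.+1) alpha k ^+ 2) <= expR (C * M).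
  by rewrite ler_expR ler_wpM2l.
apply: (@le_trans _ _ (1 + W n)); first lra.
by apply: le_trans h _; rewrite ler_wpM2r// addr_ge0.
Qed.

(** While [err] stays below [c * eps / 2], the excess of [x] over [eps / 2] decays
    at least like the exponential of [- c] times the sum of the stepsizes. *)
Lemma vanishing_recursion x alpha (c : R) (err : nat -> R) :
  0 < c -> (forall n, 0 <= alpha n.+1) -> (forall n, c * alpha n.+1 <= 1) ->
  (forall n, 0 <= x n) ->
  (forall n, x n.+1 <= (1 - c * alpha n.+1) * x n + alpha n.+1 * err n) ->
  (forall M, exists n, M <= \sum_(1 <= k < n.+1) alpha k) ->
  err @ \oo --> 0 -> x @ \oo --> 0.
Proof.
move=> c0 al0 al1 x0 xrec sM err0.
pose T n := \sum_(1 <= k < n.+1) alpha k.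
have TS n : T n.+1 = T n + alpha n.+1 by rewrite /T big_nat_recr.
have Tmono n m : T n <= T (n + m)%N.
  by elim: m => [|m IH]; rewrite ?addn0// addnS TS ler_wpDr.
apply/cvgrPdist_le => eps eps0.
have ceps : 0 < c * (eps / 2) by rewrite !mulr_gt0// invr_gt0.
move/cvgrPdist_le : err0 => /(_ _ ceps)[n0 _ err0].
have e_le n : (n0 <= n)%N -> err n <= c * (eps / 2).
  by move=> /err0 /=; rewrite sub0r normrN => /(le_trans (ler_norm _)).
have key m : x (n0 + m)%N <=
    eps / 2 + expR (- (c * (T (n0 + m)%N - T n0))) * x n0.
  elim: m => [|m IH].
    rewrite addn0 subrr mulr0 oppr0 expR0 mul1r lerDr; lra.
  rewrite addnS TS; set al := alpha _.
  have aln : 0 <= al by exact: al0.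
  have al1n : 0 <= 1 - c * al by rewrite subr_ge0 al1.
  apply: le_trans (xrec _) _; rewrite -/al.
  have h1 := ler_wpM2l aln (e_le _ (leq_addr m n0)).
  have h2 := ler_wpM2l al1n IH.
  set E := expR (- (c * (T (n0 + m)%N - T n0))) in IH h2.
  have h3 : (1 - c * al) * E <= expR (- (c * (T (n0 + m)%N + al - T n0))).
    have -> : - (c * (T (n0 + m)%N + al - T n0)) =
      - (c * al) + - (c * (T (n0 + m)%N - T n0)) by ring.
    by rewrite expRD ler_wpM2r ?expR_ge0// expR_ge1Dx.
  have h4 := ler_wpM2r (x0 n0) h3.
  by move: h1 h2 h4; rewrite mulrDr; lra.
pose M := T n0 + c^-1 * (2 * x n0 / eps).
have [n1 Mn1] := sM M.
exists (maxn n0 n1) => // n /=; rewrite geq_max => /andP[n0n n1n].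
rewrite sub0r normrN ger0_norm//.
have := key (n - n0)%N; rewrite subnKC// => /le_trans; apply.
have TM : M <= T n by apply: (le_trans Mn1); rewrite -(subnKC n1n); exact: Tmono.
set t := c * (T n - T n0).
have t_ge : 2 * x n0 / eps <= t.
  by rewrite /t -ler_pdivrMl// lerBrDl.
have q0 : 0 <= 2 * x n0 / eps by rewrite !mulr_ge0// invr_ge0 ltW.
suff : expR (- t) * x n0 <= eps / 2 by lra.
have t0 : 0 <= t by exact: le_trans t_ge.
rewrite expRN ler_pdivrMl ?expR_gt0//.
apply: (@le_trans _ _ (t * (eps / 2))); last first.
  by rewrite ler_wpM2r ?divr_ge0 ?(ltW eps0)//; have := expR_ge1Dx t; lra.
apply: le_trans (ler_wpM2r _ t_ge); last by rewrite divr_ge0// ltW.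
by rewrite le_eqVlt; apply/orP; left; apply/eqP; field; rewrite gt_eqF.
Qed.

End Recursions.

Section StepsizeRecursions.
Variables (R : realType) (a : R).
Hypothesis a_gt : 4%:R / 5%:R < a.
Hypothesis a_le1 : a <= 1.
Notation alpha := (stepsize a).
Implicit Types W B : nat -> R.

Let al0 n : 0 <= alpha n. Proof. exact/ltW/stepsize_gt0. Qed.
Let al1 n : alpha n.+1 <= 1.
Proof.
exact: le_trans (stepsize_le1 a_gt (ltn0Sn n)) (ltW (stepsize1_lt1 a_gt)).
Qed.

(** The products [tau * W] satisfy a recursion with a restoring force towards
    [M / c], where [M] bounds [W]; the remaining forcing [alpha ^+ 2 * tau] is
    summable. *)
Lemma second_moment_rate W c C : 0 < c <= 1 -> 0 <= C -> (forall n, 0 <= W n) ->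
  (forall n, W n.+1 <= (1 - c * alpha n.+1 + C * alpha n.+1 ^+ 2) * W n
                       + C * alpha n.+1 ^+ 2) ->
  exists2 K, 0 <= K & forall n, W n <= K /\ tau alpha n * W n <= K.
Proof.
move=> /andP[c0 c1] C0 W0 Wrec.
pose M := expR (C * (5%:R / 2%:R)) * (1 + W 0%N).
have WM n : W n <= M.
  apply: (@gronwall_bound _ _ alpha) => //; last first.
    by move=> m; exact: sum_stepsize_sqr.
  move=> m; apply: le_trans (Wrec m) _; rewrite lerD2r ler_wpM2r//.
  have : 0 <= c * alpha m.+1 by rewrite mulr_ge0// ltW.
  by lra.
have M0 : 0 <= M by exact: le_trans (WM 0%N).
pose C4 := C * (1 + M).
have C40 : 0 <= C4 by rewrite mulr_ge0// addr_ge0.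
have Wrec' n : W n.+1 <= (1 - c * alpha n.+1) * W n + C4 * alpha n.+1 ^+ 2.
  apply: le_trans (Wrec n) _; rewrite mulrDl -addrA lerD2l.
  have h : 0 <= C * alpha n.+1 ^+ 2 by rewrite mulr_ge0// sqr_ge0.
  have := ler_wpM2l h (WM n).
  have -> : C4 * alpha n.+1 ^+ 2 = C * alpha n.+1 ^+ 2 * M + C * alpha n.+1 ^+ 2.
    by rewrite /C4; ring.
  by lra.
have xM n : tau alpha n * W n <=
    M / c + C4 * \sum_(1 <= k < n.+1) alpha k ^+ 2 * tau alpha k.
  elim: n => [|n IH].
    by rewrite tau0 mul0r big_geq// mulr0 addr0 divr_ge0// ltW.
  rewrite big_nat_recr//=; set Sn := \sum_(_ <= _ < _) _ in IH *.
  set al := alpha n.+1; set t := tau alpha n in IH *; set t' := tau alpha n.+1.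
  have aln : 0 <= al by exact: al0.
  have Sn0 : 0 <= Sn.
    by apply: sumr_ge0 => k _; rewrite mulr_ge0 ?sqr_ge0 ?tau_ge0.
  have t'0 : 0 <= t' by exact: tau_ge0.
  have t0 : 0 <= t by exact: tau_ge0.
  have t't : t' <= t + al.
    by rewrite /t' tau_recr// lerD2l ler_piMr// gerBl.
  have cal : 0 <= 1 - c * al.
    by rewrite subr_ge0 mulr_ile1 ?al1 // ltW.
  apply: le_trans (ler_wpM2l t'0 (Wrec' n)) _; rewrite -/al.
  have h1 : t' * ((1 - c * al) * W n) <= (t + al) * ((1 - c * al) * W n).
    by rewrite ler_wpM2r// mulr_ge0.
  have h2 := ler_wpM2l cal IH.
  have h3 : al * ((1 - c * al) * W n) <= al * M.
    rewrite ler_wpM2l//; apply: le_trans (WM n).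
    by rewrite ler_piMl// gerBl mulr_ge0// ltW.
  have h4 : (1 - c * al) * (M / c + C4 * Sn) <= M / c - al * M + C4 * Sn.
    have -> : (1 - c * al) * (M / c + C4 * Sn) =
      M / c - al * M + C4 * Sn - c * al * (C4 * Sn).
      by field; rewrite gt_eqF.
    by rewrite gerBl; apply: mulr_ge0; apply: mulr_ge0 => //; exact: ltW.
  rewrite mulrDr; have -> : t' * (C4 * al ^+ 2) = C4 * (al ^+ 2 * t') by ring.
  by move: h1 h2 h3 h4; rewrite mulrDl mulrDr; lra.
have K0 : 0 <= M / c + C4 * (25%:R / 2%:R).
  apply: addr_ge0; first by rewrite divr_ge0// ltW.
  by apply: mulr_ge0 => //; rewrite divr_ge0.
exists (M + (M / c + C4 * (25%:R / 2%:R))); first exact: addr_ge0.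
move=> n; split; first by rewrite ler_wpDr.
apply: le_trans (xM n) _; apply: ler_wpDl => //; rewrite lerD2l ler_wpM2l//.
exact: sum_stepsize_sqr_tau.
Qed.

(** As [1 / (n + 1) <= alpha n], the factor [1 - alpha n] makes [(n + 1) * B n]
    grow only through the forcing term. *)
Lemma averaged_noise_rate B C : 0 <= C -> B 0%N <= 0 ->
  (forall n, 0 <= B n) ->
  (forall n, B n.+1 <= (1 - alpha n.+1) * B n + C * alpha n.+1 ^+ 2) ->
  forall n, B n <= C * (5%:R / 2%:R) * n.+1%:R `^ (- (3%:R / 5%:R)).
Proof.
move=> C0 B00 B0 Brec n.
have h : n.+1%:R * B n <= C * \sum_(1 <= k < n.+1) alpha k ^+ 2 * k.+1%:R.
  elim: n => [|n IH]; first by rewrite big_geq// mulr0 mul1r.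
  rewrite big_nat_recr//= mulrDr.
  apply: le_trans (ler_wpM2l (ler0n _ _) (Brec n)) _; rewrite mulrDr.
  apply: lerD; last by rewrite mulrA [_ * C]mulrC -mulrA [_ * alpha _ ^+ 2]mulrC.
  apply: le_trans IH; rewrite mulrA ler_wpM2r//.
  rewrite mulrBr mulr1 lerBlDr -[n.+2%:R]natr1 lerD2l natr1.
  by rewrite -ler_pdivrMl ?ltr0n// mulr1 stepsize_ge.
have n0 : 0 < n.+1%:R :> R by rewrite ltr0n.
rewrite -(ler_pM2l n0); apply: (le_trans h).
apply: le_trans (ler_wpM2l C0 (sum_stepsize_sqr_lin a_gt n)) _.
rewrite le_eqVlt; apply/orP; left; apply/eqP.
have -> : 2%:R / 5%:R = 1 + - (3%:R / 5%:R) :> R by field.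
rewrite powRD; last by rewrite (gt_eqF n0) implybT.
by rewrite powRr1 ?(ltW n0)//; ring.
Qed.

(** Reduces both asymptotic claims to lower bounds on [tau]. *)
Lemma residual_rate_bigO (v : nat -> R) (kappa c : R) : 0 < c ->
  (\forall n \near \oo, 0 < v n /\ c * v n <= tau alpha n) ->
  (fun n : nat => kappa / Num.sqrt (tau alpha n) : R^o) =O_\oo
  (fun n : nat => 1 / Num.sqrt (v n) : R^o).
Proof.
move=> c0 vtau; apply/eqO_exP; exists (`|kappa| / Num.sqrt c + 1).
  by rewrite ltr_wpDl// divr_ge0// sqrtr_ge0.
near=> n.
have [v0 cv] : 0 < v n /\ c * v n <= tau alpha n by near: n.
have sc : 0 < Num.sqrt c by rewrite sqrtr_gt0.
have sv : 0 < Num.sqrt (v n) by rewrite sqrtr_gt0.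
rewrite normrM normfV (ger0_norm (sqrtr_ge0 _)) div1r normfV.
rewrite (ger0_norm (sqrtr_ge0 (v n))).
apply: (@le_trans _ _ (`|kappa| / Num.sqrt c / Num.sqrt (v n))); last first.
  by rewrite ler_pM2r ?invr_gt0// lerDl.
rewrite -mulrA ler_wpM2l// -invfM lef_pV2 ?posrE ?mulr_gt0//.
  by rewrite -sqrtrM ?(ltW c0)// ler_wsqrtr.
by rewrite sqrtr_gt0 (lt_le_trans _ cv)// mulr_gt0.
Unshelve. all: by end_near. Qed.

Lemma tau_polynomial : exists2 c, 0 < c & forall n, (0 < n)%N ->
  c * n%:R `^ (1 - a) <= tau alpha n.
Proof.
have lt1 := stepsize1_lt1 a_gt.
have a0 : 0 < a by apply: lt_trans a_gt; rewrite divr_gt0 ?ltr0n.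
exists ((1 - alpha 1%N) * 2 `^ (- a)).
  by rewrite mulr_gt0 ?powR_gt0// subr_gt0.
move=> n n0; have nr0 : 0 < n%:R :> R by rewrite ltr0n.
apply: le_trans (tau_ge_sum a_gt n); rewrite -mulrA ler_wpM2l ?subr_ge0 ?(ltW lt1)//.
rewrite powRD; last by rewrite (gt_eqF nr0) implybT.
rewrite powRr1 ?(ltW nr0)// mulrCA -powRM ?(ltW nr0)//.
apply: (@le_trans _ _ (\sum_(1 <= k < n.+1) (2 * n%:R) `^ (- a))).
  by rewrite sumr_const_nat subn1/= -[leRHS]mulr_natl.
rewrite big_nat_cond [leRHS]big_nat_cond.
apply: ler_sum => k /andP[/andP[k0 kn] _]; rewrite stepsizeE.
rewrite !powRN lef_pV2 ?posrE ?powR_gt0 ?mulr_gt0 ?ltr0n//.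
apply: ge0_ler_powR; rewrite ?nnegrE ?(ltW a0) ?mulr_ge0//.
by rewrite -natrM ler_nat mul2n -addnn -addn1 leq_add.
Qed.

Lemma tau_logarithmic : exists2 c, 0 < c & forall n, (4 <= n)%N ->
  0 < ln n%:R :> R /\ c * ln n%:R <= tau alpha n.
Proof.
have lt1 := stepsize1_lt1 a_gt.
exists ((1 - alpha 1%N) * 2^-1).
  by rewrite mulr_gt0 ?invr_gt0// subr_gt0.
move=> n n4; have nr0 : 0 < n%:R :> R by rewrite ltr0n (leq_trans _ n4).
split; first by rewrite ln_gt0// ltr1n (leq_trans _ n4).
apply: le_trans (tau_ge_sum a_gt n); rewrite -mulrA ler_wpM2l ?subr_ge0 ?(ltW lt1)//.
apply: le_trans (ln_le_sum_stepsize a_le1 n).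
have h1 : ln n%:R <= ln n.+2%:R :> R.
  by rewrite ler_ln ?posrE// ler_nat; do 2!apply: leqW.
have h2 : ln 4%:R <= ln n%:R :> R by rewrite ler_ln ?posrE// ler_nat.
have h3 : ln 4%:R = 2 * ln 2%:R :> R.
  have -> : 4%:R = 2%:R * 2%:R :> R by ring.
  by rewrite lnM ?posrE// mulr2n mulrDl mul1r.
move: h1 h2; rewrite h3.
by set x := ln _; set y := ln _; set z := ln _; lra.
Qed.

End StepsizeRecursions.

(** * Variables adapted to the samples *)

Section AdaptedVariables.
Variables (R : realType) (S A : finType) (p : S -> A -> S -> R).
Variables (d : measure_display) (Omega : measurableType d).
Variables (P : probability Omega R) (xi : nat -> S -> A -> Omega -> S).
Hypothesis xi_measurable : forall n i u j, (1 <= n)%N ->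
  measurable (xi n i u @^-1` [set j]).
Hypothesis xi_law : forall n i u j, (1 <= n)%N ->
  P (xi n i u @^-1` [set j]) = (p i u j)%:E.
Hypothesis xi_independent : mutually_independent P
  [set k : nat * S * A | (1 <= k.1.1)%N]
  (fun k : nat * S * A => xi k.1.1 k.1.2 k.2).

(** Adaptedness is stated pointwise, which makes its closure properties
    immediate; measurability follows because the samples up to time [n] take
    finitely many values. *)
Definition adapted (n : nat) (T : Type) (Y : Omega -> T) : Prop :=
  forall w w', (forall m i u, (1 <= m <= n)%N -> xi m i u w = xi m i u w') ->
  Y w = Y w'.

Lemma adapted_mono n m T (Y : Omega -> T) : (n <= m)%N ->
  adapted n Y -> adapted m Y.
Proof.
move=> nm aY w w' h; apply: aY => k i u /andP[k1 kn]; apply: h.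
by rewrite k1 (leq_trans kn).
Qed.

Lemma adapted_sample n i u : adapted n.+1 (xi n.+1 i u).
Proof. by move=> w w'; apply; rewrite /= leqnn. Qed.

Lemma adapted_comp n T U (F : T -> U) (Y : Omega -> T) :
  adapted n Y -> adapted n (fun w => F (Y w)).
Proof. by move=> aY w w' h; rewrite (aY w w' h). Qed.

Lemma adapted_comp2 n T U V (F : T -> U -> V) (Y : Omega -> T) (Z : Omega -> U) :
  adapted n Y -> adapted n Z -> adapted n (fun w => F (Y w) (Z w)).
Proof. by move=> aY aZ w w' h; rewrite (aY w w' h) (aZ w w' h). Qed.

Lemma adapted_sum n (I : Type) (s : seq I) (Q : pred I) (Y : I -> Omega -> R) :
  (forall i, Q i -> adapted n (Y i)) ->
  adapted n (fun w => \sum_(i <- s | Q i) Y i w).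
Proof.
by move=> aY w w' h; apply: eq_bigr => i Qi; rewrite (aY i Qi w w' h).
Qed.

Section History.
Variable n : nat.

Let hist := {ffun 'I_n * S * A -> S}.
Let past (w : Omega) : hist := [ffun k : 'I_n * S * A => xi k.1.1.+1 k.1.2 k.2 w].
Let keys : seq (nat * S * A) :=
  [seq ((k.1.1 : nat).+1, k.1.2, k.2) | k : 'I_n * S * A <- enum {: 'I_n * S * A}].
(* fits h k constrains the sample at key k only if its time occurs in h. *)
Let fits (h : hist) (k : nat * S * A) : set S :=
  [set j | forall m : 'I_n, m.+1 = k.1.1 -> h (m, k.1.2, k.2) = j].
Let sample (k : nat * S * A) := xi k.1.1 k.1.2 k.2.

Let pastE h : past @^-1` [set h] = \bigcap_(k in [set` keys]) sample k @^-1` fits h k.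
Proof.
apply/seteqP; split => w /=.
  move=> <- k _ m /= mk; rewrite ffunE /=.
  by rewrite /sample -mk.
move=> wk; apply/ffunP => -[[m i] u]; rewrite ffunE/=.
have := wk (m.+1, i, u); rewrite /fits/= => -> //.
by apply/mapP; exists (m, i, u); rewrite ?mem_enum.
Qed.

Let keys_pos k : k \in keys -> (1 <= k.1.1 <= n)%N.
Proof. by move=> /mapP[[[m i] u] _ ->] /=; rewrite ltn_ord. Qed.

Let keys_uniq : uniq keys.
Proof.
rewrite map_inj_uniq ?enum_uniq// => -[[m i] u] [[m' i'] u'] /= [mm -> ->].
by congr (_, _, _); apply/val_inj.
Qed.

Let measurable_sample k (B : set S) : (1 <= k.1.1)%N ->
  measurable (sample k @^-1` B).
Proof.
move=> k1; rewrite (_ : _ @^-1` B =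
    \bigcup_(j in B) (sample k @^-1` [set j])).
  apply: fin_bigcup_measurable => // j _; exact: xi_measurable.
by apply/seteqP; split => w /= => [Bw|[j Bj ->]//]; exists (sample k w).
Qed.

Let measurable_past h : measurable (past @^-1` [set h]).
Proof.
rewrite pastE; apply: fin_bigcap_measurable; first exact: finite_seq.
by move=> k /= /keys_pos/andP[k1 _]; exact: measurable_sample.
Qed.

Let past_independent h i u j :
  P (past @^-1` [set h] `&` xi n.+1 i u @^-1` [set j]) =
  (P (past @^-1` [set h]) * (p i u j)%:E)%E.
Proof.
pose k0 : nat * S * A := (n.+1, i, u).
have k0N : k0 \notin keys.
  by apply/negP => /keys_pos; rewrite /= ltnn.
pose B k := if k == k0 then [set j] else fits h k.
have BE k : k \in keys -> B k = fits h k.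
  by move=> kk; rewrite /B; case: eqP => // kk0; rewrite -kk0 kk in k0N.
have sub : [set` keys] `<=` [set k : nat * S * A | (1 <= k.1.1)%N].
  by move=> k /= /keys_pos/andP[].
have -> : past @^-1` [set h] `&` xi n.+1 i u @^-1` [set j] =
    \bigcap_(k in [set` k0 :: keys]) sample k @^-1` B k.
  rewrite pastE; apply/seteqP; split => w /=.
    move=> [wk wj] k /=; rewrite inE => /predU1P[->|kk].
      by rewrite /B eqxx.
    by rewrite (BE k kk); exact: wk.
  move=> wk; split.
    by move=> k /= kk; rewrite -(BE k kk); apply: wk => /=; rewrite inE kk orbT.
  by have := wk k0; rewrite /B eqxx; apply => /=; rewrite inE eqxx.
have uk : uniq (k0 :: keys) by rewrite /= k0N keys_uniq.
have subk : [set` k0 :: keys] `<=` [set k : nat * S * A | (1 <= k.1.1)%N].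
  by move=> k /=; rewrite inE => /predU1P[->//|]; exact: sub.
rewrite [LHS](xi_independent B uk subk) big_cons {1}/B eqxx [X in (X * _)%E]xi_law//.
rewrite muleC; congr (_ * _)%E.
rewrite pastE [RHS](xi_independent (fits h) keys_uniq sub).
rewrite big_seq [RHS]big_seq; apply: eq_bigr => k kk.
by rewrite BE.
Qed.

Let adapted_decomp (Y : Omega -> R) : adapted n Y ->
  exists y : hist -> R, Y = fun w => \sum_h y h * \1_(past @^-1` [set h]) w.
Proof.
move=> aY.
have [y yP] : exists y : hist -> R, forall w, y (past w) = Y w.
  exists (fun h => if pselect (exists w, past w = h) is left e
                   then Y (projT1 (cid e)) else 0) => w.
  case: pselect => [e|]; last by move=> []; exists w.
  case: cid => w' /= /ffunP pw; apply: aY => m i u /andP[m1 mn].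
  have mn' : (m.-1 < n)%N by rewrite prednK.
  by have := pw (Ordinal mn', i, u); rewrite !ffunE/= prednK.
exists y; apply/funext => w; rewrite (bigD1 (past w))//= yP.
rewrite indicE mem_set//= mulr1 big1 ?addr0// => h hw.
rewrite indicE memNset ?mulr0//= => pw; move: hw; by rewrite pw eqxx.
Qed.

Lemma adapted_measurable (Y : Omega -> R) : adapted n Y ->
  measurable_fun setT Y.
Proof.
move=> /adapted_decomp[y ->]; apply: measurable_sum => h.
apply: measurable_funM; first exact: measurable_cst.
exact: measurable_indic.
Qed.

Lemma adapted_integrable (Y : Omega -> R) : adapted n Y ->
  P.-integrable setT (EFin \o Y).
Proof.
move=> aY; apply: measurable_bounded_integrable => //.
- by rewrite (le_lt_trans (probability_le1 P _))// ltry.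
- exact: adapted_measurable.
have [y yE] := adapted_decomp aY.
exists (\sum_h `|y h|); split; first by rewrite num_real.
move=> M lM w _ /=; apply: le_trans (ltW lM); rewrite yE.
apply: le_trans (ler_norm_sum _ _ _) _; apply: ler_sum => h _.
by rewrite normrM ler_piMr// indicE; case: (_ \in _); rewrite ?normr0 ?normr1.
Qed.

Lemma mean_indicator_next (Y : Omega -> R) i u j : adapted n Y ->
  \int[P]_w (Y w * \1_(xi n.+1 i u @^-1` [set j]) w) =
  \int[P]_w Y w * p i u j.
Proof.
move=> aY; have [y YE] := adapted_decomp aY.
have mI (B : set Omega) c : measurable B ->
    P.-integrable setT (EFin \o (fun w => c * \1_B w)).
  move=> mB; apply: measurable_bounded_integrable => //.
  - by rewrite (le_lt_trans (probability_le1 P _))// ltry.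
  - apply: measurable_funM; first exact: measurable_cst.
    exact: measurable_indic.
  exists `|c|; split; first by rewrite num_real.
  move=> M lM w _ /=; apply: le_trans (ltW lM); rewrite normrM ler_piMr// indicE.
  by case: (_ \in _); rewrite ?normr0 ?normr1.
have mean_ind (B : set Omega) c : measurable B ->
    \int[P]_w (c * \1_B w) = c * fine (P B).
  move=> mB; rewrite RintegralZl//.
    by rewrite /Rintegral integral_indic// setIT.
  have := mI B 1 mB; apply: eq_integrable => // w _ /=; by rewrite mul1r.
have mean_fin (B : hist -> set Omega) : (forall h, measurable (B h)) ->
    \int[P]_w (\sum_h y h * \1_(B h) w) = \sum_h y h * fine (P (B h)).
  move=> mB; rewrite /Rintegral.
  under eq_integral do rewrite -sumEFin.
  rewrite integral_sum//; last first.
    by move=> h; exact: (mI _ (y h)).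
  rewrite -sum_fine; last first.
    move=> h _; apply: integrable_fin_num => //.
    exact: (mI _ (y h)).
  by apply: eq_bigr => h _; exact: mean_ind.
have mxi : measurable (xi n.+1 i u @^-1` [set j]) by exact: xi_measurable.
rewrite {2}YE mean_fin// mulr_suml.
transitivity (\int[P]_w (\sum_h y h *
    \1_(past @^-1` [set h] `&` xi n.+1 i u @^-1` [set j]) w)).
  apply: eq_Rintegral => w _; rewrite YE mulr_suml; apply: eq_bigr => h _.
  by rewrite -mulrA indicI.
rewrite mean_fin; last by move=> h; exact: measurableI.
apply: eq_bigr => h _; rewrite past_independent fineM//.
  by rewrite mulrA.
by rewrite fin_num_measure.
Qed.

End History.

Notation "'EE' Y" := (\int[P]_w Y w) (at level 10, Y at level 9).

Lemma mean_le n (Y Z : Omega -> R) : adapted n Y -> adapted n Z ->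
  (forall w, Y w <= Z w) -> EE Y <= EE Z.
Proof.
move=> aY aZ YZ; apply: le_Rintegral => [//|||w _]; last exact: YZ.
- exact: adapted_integrable aY.
- exact: adapted_integrable aZ.
Qed.

Lemma mean_add n (Y Z : Omega -> R) : adapted n Y -> adapted n Z ->
  \int[P]_w (Y w + Z w) = EE Y + EE Z.
Proof.
move=> aY aZ; apply: RintegralD => //.
- exact: adapted_integrable aY.
- exact: adapted_integrable aZ.
Qed.

Lemma mean_scale n c (Y : Omega -> R) : adapted n Y ->
  \int[P]_w (c * Y w) = c * EE Y.
Proof. by move=> aY; apply: RintegralZl => //; exact: adapted_integrable aY. Qed.

Lemma mean_cst c : \int[P]_(w in [set: Omega]) c = c.
Proof. by rewrite Rintegral_cst// [X in fine X]probability_setT mulr1. Qed.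

Lemma mean_sum n (I : Type) (s : seq I) (Y : I -> Omega -> R) :
  (forall i, adapted n (Y i)) ->
  \int[P]_w (\sum_(i <- s) Y i w) = \sum_(i <- s) EE (Y i).
Proof.
move=> aY; elim: s => [|i s IH].
  rewrite big_nil -[RHS](mean_cst 0); apply: eq_Rintegral => w _.
  by rewrite big_nil.
rewrite big_cons -IH -(@mean_add n)//; last exact: adapted_sum.
by apply: eq_Rintegral => w _; rewrite big_cons.
Qed.

Lemma mean_ge0 (Y : Omega -> R) : (forall w, 0 <= Y w) -> 0 <= EE Y.
Proof. by move=> Y0; apply: Rintegral_ge0 => w _; exact: Y0. Qed.

Lemma mean_expectation n (Y : Omega -> R) : adapted n Y ->
  ('E_P[Y] = (EE Y)%:E)%E.
Proof.
move=> aY; rewrite unlock /Rintegral fineK//.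
by apply: integrable_fin_num => //; exact: adapted_integrable aY.
Qed.

(** Jensen's inequality for the square, from the nonnegativity of the variance. *)
Lemma mean_sqr_le n (Y : Omega -> R) : adapted n Y ->
  (EE Y) ^+ 2 <= \int[P]_w (Y w ^+ 2).
Proof.
move=> aY; set m := EE Y.
have : 0 <= \int[P]_w ((Y w ^+ 2 + (- (2 * m)) * Y w) + m ^+ 2).
  apply: mean_ge0 => w; have := sqr_ge0 (Y w - m).
  by rewrite sqrrB mulr_natl -mulrnAl mulrC; lra.
have a2 : adapted n (fun w => Y w ^+ 2) by exact: (adapted_comp (fun x => x ^+ 2)).
have a1 : adapted n (fun w => - (2 * m) * Y w).
  exact: (adapted_comp (fun x => - (2 * m) * x)).
rewrite (@mean_add n) ?(@mean_add n)//; last first.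
  exact: (adapted_comp2 (fun x y => x + y)).
rewrite mean_cst (@mean_scale n)// -/m.
by lra.
Qed.

(** The next sample is independent of every variable adapted to the past, so it
    may be averaged out under its own law. *)
Lemma mean_next_sample n (F : S -> Omega -> R) i u :
  (forall j, adapted n (F j)) ->
  \int[P]_w (F (xi n.+1 i u w) w) = \int[P]_w (\sum_j p i u j * F j w).
Proof.
move=> aF.
have -> : \int[P]_w (F (xi n.+1 i u w) w) =
    \int[P]_w (\sum_j F j w * \1_(xi n.+1 i u @^-1` [set j]) w).
  apply: eq_Rintegral => w _; rewrite (bigD1 (xi n.+1 i u w))//=.
  rewrite indicE mem_set//= mulr1 big1 ?addr0// => j jw.
  by rewrite indicE memNset ?mulr0//= => h; move: jw; rewrite h eqxx.
have aI j : adapted n.+1 (fun w => \1_(xi n.+1 i u @^-1` [set j]) w : R).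
  move=> w w' h; rewrite !indicE; congr (nat_of_bool _)%:R.
  by apply/idP/idP; rewrite !inE/= (@adapted_sample n i u w w' h).
have aFn j : adapted n.+1 (F j) by exact: adapted_mono (aF j).
rewrite (@mean_sum n.+1); last first.
  by move=> j; exact: (adapted_comp2 (fun x y => x * y)).
rewrite (@mean_sum n); last first.
  by move=> j; exact: (adapted_comp (fun x => p i u j * x)).
apply: eq_bigr => j _.
by rewrite (@mean_scale n)// mulrC (mean_indicator_next _ _ _ (aF j)).
Qed.

End AdaptedVariables.

(** * Almost sure convergence from summable means *)

Section AlmostSureConvergence.
Variables (R : realType) (d : measure_display) (Omega : measurableType d).
Variable P : probability Omega R.

(** The sum of all the variables has finite expectation, hence is almost surely
    finite. *)
Lemma summable_mean_cvg0 (X : nat -> Omega -> R) (M : R) :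
  (forall k w, 0 <= X k w) -> (forall k, P.-integrable setT (EFin \o X k)) ->
  (forall n, \sum_(0 <= k < n) \int[P]_w X k w <= M) ->
  {ae P, forall w, X k w @[k --> \oo] --> 0}.
Proof.
move=> X0 iX sM.
have mX k : measurable_fun setT (EFin \o X k).
  by have /integrableP[] := iX k.
have X0e k w : (0 <= (X k w)%:E)%E by rewrite lee_fin.
have intS : (\int[P]_w (\sum_(k <oo) (X k w)%:E) <= M%:E)%E.
  rewrite integral_nneseries//.
  apply: lime_le; first by apply: is_cvg_nneseries => n _ _; exact: integral_ge0.
  apply: nearW => n; rewrite (eq_bigr (fun k => (\int[P]_w X k w)%:E)).
    by rewrite sumEFin lee_fin.
  by move=> k _; rewrite /Rintegral fineK//; exact: (integrable_fin_num measurableT (iX k)).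
have iS : P.-integrable setT (fun w => \sum_(k <oo) (X k w)%:E)%E.
  apply/integrableP; split.
    apply: (@ge0_emeasurable_sum _ _ _ setT (fun k w => (X k w)%:E) xpredT).
      by move=> k w _ _; exact: X0e.
    by move=> k _; exact: mX.
  apply: le_lt_trans (ltry M); apply: le_trans intS.
  rewrite le_eqVlt; apply/orP; left; apply/eqP; apply: eq_integral => w _.
  by rewrite gee0_abs// nneseries_ge0.
have := integrable_ae measurableT iS; apply: filterS => w /(_ I) fin.
apply: cvg_series_cvg_0; apply: nondecreasing_is_cvgn.
  by apply: nondecreasing_series => k _ _; exact: X0.
exists (fine (\sum_(k <oo) (X k w)%:E)%E) => _ [n _ <-].
rewrite -lee_fin fineK// /series/= -sumEFin.
by apply: nneseries_lim_ge => k _ _; exact: X0e.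
Qed.

End AlmostSureConvergence.

(** * The iterates and their averaged noise *)

Section Iteration.
Variables (R : realType) (S A : finType) (a0 : A) (p g : S -> A -> S -> R).
Hypothesis p_ge0 : forall i u j, 0 <= p i u j.
Hypothesis p_sum1 : forall i u, \sum_j p i u j = 1.
Variable gbar : R.
Hypothesis g_bounds : forall i u j, 0 <= g i u j <= gbar.

Notation Qs := (Qspace R S A).
Notation H := (bellmanH a0 p g).
Notation vmax := (vmax a0).
Notation e := (const_mx 1 : Qs).

Variables (f : Qs -> R) (alpha : nat -> R) (Q0 : Qs).

Section Path.
Variable x : nat -> S -> A -> S.
Notation q := (rviQ a0 g f alpha Q0 x).

Definition sample_gap (Q : Qs) (i : S) (u : A) (j : S) : R :=
  g i u j + vmax Q j - \sum_l p i u l * (g i u l + vmax Q l).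

(** Index [n] carries the noise that enters the iterate number [n + 1]. *)
Definition noise (n : nat) : Qs :=
  mkQ (fun i u => sample_gap (q n) i u (x n.+1 i u)).

Fixpoint avg_noise (n : nat) : Qs :=
  if n is m.+1 then (1 - alpha n) *: avg_noise m + alpha n *: noise m else 0.

(** Subtracting the averaged noise leaves a recursion in which the noise enters
    only through the point where the Bellman operator is evaluated. *)
Definition denoised (n : nat) : Qs := q n - avg_noise n.

Lemma rviQ_recr r n : q n.+1 = (1 - alpha n.+1) *: q n +
  alpha n.+1 *: (H r (q n) + noise n + (r - f (q n)) *: e).
Proof.
apply/rowP => k; rewrite /= !mxE.
have -> : qval (q n) (enum_val k).1 (enum_val k).2 = q n ord0 k.
  by rewrite /qval -surjective_pairing enum_valK.
congr (_ + _ * _); rewrite /sample_gap -/(vmax (q n)).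
rewrite -[fmax _ _]/(vmax (q n) _).
have -> : \sum_j p (enum_val k).1 (enum_val k).2 j *
   (g (enum_val k).1 (enum_val k).2 j + fmax a0 (fun u' => qval (q n) j u')) =
   \sum_j p (enum_val k).1 (enum_val k).2 j *
   (g (enum_val k).1 (enum_val k).2 j + vmax (q n) j) by [].
by rewrite mulr1; ring.
Qed.

Lemma denoised_recr r n : denoised n.+1 = (1 - alpha n.+1) *: denoised n +
  alpha n.+1 *: (H r (q n) + (r - f (q n)) *: e).
Proof.
rewrite /denoised (rviQ_recr r n) /=.
move: (avg_noise n) (noise n) (q n) (H r (q n)) (r - f (q n)) => a b c D t.
by apply/rowP => k; rewrite !mxE; ring.
Qed.

Lemma avg_noise_step n : 0 <= alpha n.+1 <= 1 ->
  `|avg_noise n.+1 - avg_noise n| <= alpha n.+1 * (`|avg_noise n| + `|noise n|).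
Proof.
move=> /andP[al0 al1].
have -> : avg_noise n.+1 - avg_noise n =
    alpha n.+1 *: (noise n - avg_noise n).
  by apply/rowP => k; rewrite !mxE; ring.
rewrite normrZ ger0_norm// ler_wpM2l// [leRHS]addrC; exact: ler_normB.
Qed.

Section Contraction.
Variables (lam : R) (N : Qs -> R) (rho C : R).
Hypothesis lam_gt0 : 0 < lam.
Hypothesis NP : lazy_contraction p lam N rho C.
Variable k0 : 'I_#|{: S * A}|.
Hypothesis alpha_lam : forall n, 0 <= alpha n.+1 <= lam.
Variables (r : R) (h : Qs).
Hypothesis hfix : H r h = h.

Notation rate := ((1 - rho) / lam).

Lemma iterate_le_denoised n :
  N (q n - h) <= N (denoised n - h) + C * `|avg_noise n|.
Proof.
have -> : q n - h = (denoised n - h) + avg_noise n.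
  by rewrite /denoised addrAC subrK.
by apply: le_trans (lc_add NP _ _) _; rewrite lerD2l; exact: lc_norm NP _.
Qed.

(** The Bellman operator is first evaluated at the denoised iterate, at the cost
    of the averaged noise by nonexpansiveness; the constant vector in the
    recursion is invisible to the seminorm. *)
Lemma denoised_contraction n : N (denoised n.+1 - h) <=
  (1 - rate * alpha n.+1) * N (denoised n - h) +
  alpha n.+1 * (C * `|avg_noise n|).
Proof.
have al := alpha_lam n; have /andP[al0 _] := al.
set be := alpha n.+1 in al al0 *.
have -> : denoised n.+1 - h =
    (((1 - be) *: (denoised n - h) + be *: (H r (denoised n) - H r h)) +
     be *: (H r (q n) - H r (denoised n))) + (be * (r - f (q n))) *: e.
  rewrite (denoised_recr r) -/be hfix.
  move: (denoised n) (H r (q n)) (H r _) (r - f (q n)) => a b c D.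
  by apply/rowP => k; rewrite !mxE; ring.
rewrite (seminorm_shift NP); apply: le_trans (lc_add NP _ _) _; apply: lerD.
  by rewrite [rate * _]mulrC; exact: (averaged_step_contraction a0 g lam_gt0 NP).
apply: le_trans (lc_scale NP _ al0) _; rewrite ler_wpM2l//.
apply: le_trans (lc_norm NP _) _; rewrite ler_wpM2l ?(ltW (lc_C NP))//.
apply: le_trans (bellman_nonexpansive a0 g p_ge0 p_sum1 _ _ _) _.
by rewrite /denoised opprB addrC subrK.
Qed.

Lemma vmax_osc (Q : Qs) j l : vmax Q j - vmax Q l <= N Q.
Proof.
have [u uE] := fmax_attained a0 (fun u => qval Q j u).
rewrite /vmax uE; apply: le_trans (lc_osc NP Q (enum_rank (j, u)) (enum_rank (l, u))).
by rewrite lerB//; exact: (fmax_ge a0 (fun u => qval Q l u)).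
Qed.

Lemma sample_gap_bound (Q : Qs) i u j : `|sample_gap Q i u j| <= gbar + N Q.
Proof.
have -> : sample_gap Q i u j =
    \sum_l p i u l * (g i u j - g i u l + (vmax Q j - vmax Q l)).
  rewrite /sample_gap -{1}[g i u j + _]mul1r -(p_sum1 i u) mulr_suml -sumrB.
  by apply: eq_bigr => l _; ring.
apply: le_trans (ler_norm_sum _ _ _) _.
rewrite -[leRHS]mul1r -(p_sum1 i u) mulr_suml; apply: ler_sum => l _.
rewrite normrM ger0_norm// ler_wpM2l// ler_norml.
have := g_bounds i u j; have := g_bounds i u l.
have := vmax_osc Q j l; have := vmax_osc Q l j.
by lra.
Qed.

Lemma noise_bound n :
  `|noise n| <= (gbar + N h) + N (denoised n - h) + C * `|avg_noise n|.
Proof.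
have Nq : N (q n) <= N h + (N (denoised n - h) + C * `|avg_noise n|).
  rewrite -[X in N X](subrKC h); apply: le_trans (lc_add NP _ _) _.
  by rewrite lerD2l; exact: iterate_le_denoised.
have gb : 0 <= gbar.
  have /andP[h1 h2] := g_bounds (enum_val k0).1 (enum_val k0).2 (enum_val k0).1.
  exact: le_trans h2.
apply: row_norm_le.
  by apply: le_trans (_ : gbar + N (q n) <= _); [rewrite addr_ge0// (seminorm_ge0 NP k0)|lra].
move=> k; rewrite mxE; apply: le_trans (sample_gap_bound _ _ _ _) _.
by move: Nq; lra.
Qed.

(** The residual does not change when a constant is subtracted from the iterate,
    so the distance to [h] modulo constants controls it. *)
Lemma residual_le n : `|q n - H r (q n)| <=
  2 * (N (denoised n - h) + C * `|avg_noise n|).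
Proof.
set c := (q n - h) ord0 k0.
set Q' := q n - c *: e.
have qE : q n = Q' + c *: e by rewrite subrK.
have -> : q n - H r (q n) = (Q' - h) - (H r Q' - H r h).
  rewrite {2}qE (bellman_shift a0 g p_sum1) hfix qE.
  move: (H r Q') => b; rewrite /Q'.
  by apply/rowP => k; rewrite !mxE; ring.
apply: le_trans (ler_normB _ _) _.
have h1 := bellman_nonexpansive a0 g p_ge0 p_sum1 r Q' h.
have h2 : `|Q' - h| <= N (q n - h).
  have -> : Q' - h = (q n - h) - (q n - h) ord0 k0 *: e.
    by rewrite /Q' -/c addrAC.
  exact: normalised_le_seminorm NP k0 _.
by have := iterate_le_denoised n; lra.
Qed.

End Contraction.

End Path.

End Iteration.

(** * Convergence along one path *)

Section PathwiseConvergence.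
Variables (R : realType) (S A : finType) (a0 : A) (p g : S -> A -> S -> R).
Hypothesis p_ge0 : forall i u j, 0 <= p i u j.
Hypothesis p_sum1 : forall i u, \sum_j p i u j = 1.

Notation Qs := (Qspace R S A).
Notation H := (bellmanH a0 p g).
Notation e := (const_mx 1 : Qs).

Variables (f : Qs -> R) (alpha : nat -> R) (Q0 : Qs) (x : nat -> S -> A -> S).
Hypothesis f_continuous : continuous f.
Hypothesis f_shift : forall (Q : Qs) (c : R), f (Q + c *: e) = f Q + c.
Notation q := (rviQ a0 g f alpha Q0 x).
Notation avg_noise := (avg_noise a0 p g f alpha Q0 x).
Notation denoised := (denoised a0 p g f alpha Q0 x).

Variables (lam : R) (N : Qs -> R) (rho C : R).
Hypothesis lam_gt0 : 0 < lam.
Hypothesis lam_le1 : lam <= 1.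
Hypothesis NP : lazy_contraction p lam N rho C.
Variable k0 : 'I_#|{: S * A}|.
Hypothesis alpha_lam : forall n, 0 <= alpha n.+1 <= lam.
Hypothesis sum_alpha : forall M, exists n, M <= \sum_(1 <= k < n.+1) alpha k.
Variables (r : R) (h : Qs).
Hypothesis hfix : H r h = h.
Hypothesis fh : f h = r.

(** Once the averaged noise vanishes, the denoised iterates approach [h] modulo
    constants. The map [Q |-> H Q - f Q *: e] ignores constants, so it then
    tends to its value at [h], and the constants are pulled to the right value
    as well. *)
Lemma iterates_cvg : `|avg_noise n| @[n --> \oo] --> 0 ->
  f (q n) @[n --> \oo] --> r /\ q n @[n --> \oo] --> h.
Proof.
move=> noise0.
have /andP[rho0 rho1] := lc_rho NP.
have rate0 : 0 < (1 - rho) / lam by rewrite divr_gt0// subr_gt0.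
have al0 n : 0 <= alpha n.+1 by case/andP: (alpha_lam n).
have al1 n : alpha n.+1 <= 1 by case/andP: (alpha_lam n) => _ /le_trans; apply.
have Cnoise0 : C * `|avg_noise n| @[n --> \oo] --> 0.
  by rewrite -[X in _ --> X](mulr0 C); exact: cvgMr.
have N0 : N (denoised n - h) @[n --> \oo] --> 0.
  apply: (vanishing_recursion rate0 al0 _ _ _ sum_alpha Cnoise0).
  - move=> n; have /andP[_ al] := alpha_lam n.
    apply: (@le_trans _ _ ((1 - rho) / lam * lam)).
      by rewrite ler_pM2l.
    by rewrite divfK ?gt_eqF//; lra.
  - by move=> n; exact: seminorm_ge0 NP k0 _.
  - move=> n; exact: (denoised_contraction p_ge0 p_sum1 f Q0 x lam_gt0 NP alpha_lam hfix).
pose D n : Qs := (q n - h) - (q n - h) ord0 k0 *: e.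
have D0 : `|D n| @[n --> \oo] --> 0.
  apply: (@squeeze_cvgr _ _ _ _ (fun=> 0) (fun n => N (denoised n - h) + C * `|avg_noise n|)).
  - apply: nearW => n; rewrite normr_ge0/=.
    apply: le_trans (normalised_le_seminorm NP k0 _) _.
    exact: iterate_le_denoised NP _ _.
  - exact: cvg_cst.
  - by rewrite -[X in _ --> X](addr0 0); exact: cvgD.
have hD : (h + D n) @[n --> \oo] --> h.
  rewrite -[X in _ --> X]addr0; apply: cvgD; first exact: cvg_cst.
  exact/norm_cvg0P.
have fD : (r - f (h + D n)) @[n --> \oo] --> 0.
  rewrite -[X in _ --> X](subrr r); apply: cvgB; first exact: cvg_cst.
  rewrite -[X in _ --> X]fh; apply: continuous_cvg hD; exact: f_continuous.
pose err n := `|D n| + `|r - f (h + D n)|.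
have err0 : err n @[n --> \oo] --> 0.
  rewrite -[X in _ --> X](addr0 0); apply: cvgD => //.
  by apply/norm_cvg0P.
have drift n : `|H r (q n) + (r - f (q n)) *: e - h| <= err n.
  have qE : q n = (h + D n) + (q n - h) ord0 k0 *: e.
    by rewrite /D; apply/rowP => k; rewrite !mxE; ring.
  have -> : H r (q n) + (r - f (q n)) *: e - h =
      (H r (h + D n) - H r h) + (r - f (h + D n)) *: e.
    rewrite {1 2}qE (bellman_shift a0 g p_sum1) f_shift hfix.
    move: (H r (h + D n)) (f (h + D n)) ((q n - h) ord0 k0) => b t c.
    by apply/rowP => k; rewrite !mxE; ring.
  apply: le_trans (ler_normD _ _) _; apply: lerD.
    apply: le_trans (bellman_nonexpansive a0 g p_ge0 p_sum1 _ _ _) _.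
    by rewrite addrAC subrr add0r.
  by apply: row_norm_le => // k; rewrite !mxE mulr1.
have dh : `|denoised n - h| @[n --> \oo] --> 0.
  apply: (vanishing_recursion ltr01 al0 _ _ _ sum_alpha err0).
  - by move=> n; rewrite mul1r.
  - by [].
  move=> n; rewrite mul1r.
  have -> : denoised n.+1 - h = (1 - alpha n.+1) *: (denoised n - h) +
      alpha n.+1 *: (H r (q n) + (r - f (q n)) *: e - h).
    rewrite (denoised_recr a0 p g f alpha Q0 x r n).
    move: (denoised n) (H r (q n)) (r - f (q n)) => b t c.
    by apply/rowP => k; rewrite !mxE; ring.
  apply: le_trans (ler_normD _ _) _; rewrite !normrZ !ger0_norm ?subr_ge0//.
  by rewrite lerD2l ler_wpM2l.
have qh : q n @[n --> \oo] --> h.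
  have -> : q = (fun n => h + ((denoised n - h) + avg_noise n)).
    by apply/funext => n; rewrite /denoised addrA addrCA subrr addr0 subrK.
  rewrite -[X in _ --> X]addr0; apply: cvgD; first exact: cvg_cst.
  rewrite -[X in _ --> X]addr0; apply: cvgD; exact/norm_cvg0P.
split=> //; rewrite -[X in _ --> X]fh.
by apply: continuous_cvg qh; exact: f_continuous.
Qed.

End PathwiseConvergence.

(** * Second moments *)

Section Moments.
Variables (R : realType) (S A : finType) (a0 : A) (p g : S -> A -> S -> R).
Hypothesis p_ge0 : forall i u j, 0 <= p i u j.
Hypothesis p_sum1 : forall i u, \sum_j p i u j = 1.
Variable gbar : R.
Hypothesis g_bounds : forall i u j, 0 <= g i u j <= gbar.

Notation Qs := (Qspace R S A).
Notation H := (bellmanH a0 p g).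

Variables (f : Qs -> R) (alpha : nat -> R) (Q0 : Qs).

Variables (d : measure_display) (Omega : measurableType d).
Variables (P : probability Omega R) (xi : nat -> S -> A -> Omega -> S).
Hypothesis xi_measurable : forall n i u j, (1 <= n)%N ->
  measurable (xi n i u @^-1` [set j]).
Hypothesis xi_law : forall n i u j, (1 <= n)%N ->
  P (xi n i u @^-1` [set j]) = (p i u j)%:E.
Hypothesis xi_independent : mutually_independent P
  [set k : nat * S * A | (1 <= k.1.1)%N]
  (fun k : nat * S * A => xi k.1.1 k.1.2 k.2).

Notation xs w := (fun m i u => xi m i u w).
Notation q n w := (rviQ a0 g f alpha Q0 (xs w) n).
Notation ns n w := (noise a0 p g f alpha Q0 (xs w) n).
Notation ub n w := (avg_noise a0 p g f alpha Q0 (xs w) n).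
Notation dn n w := (denoised a0 p g f alpha Q0 (xs w) n).

Lemma adapted_rviQ n : adapted xi n (fun w => q n w).
Proof.
elim: n => [|n IH] w w' hw //=.
have -> : q n w = q n w' by apply: (adapted_mono (leqnSn n) IH).
congr mkQ; apply/funext => i; apply/funext => u.
by rewrite hw//= leqnn.
Qed.

Lemma adapted_noise n : adapted xi n.+1 (fun w => ns n w).
Proof.
move=> w w' hw; rewrite /noise.
have -> : q n w = q n w'.
  by apply: (adapted_mono (leqnSn n) (@adapted_rviQ n)).
congr mkQ; apply/funext => i; apply/funext => u.
by rewrite hw//= leqnn.
Qed.

Lemma adapted_avg_noise n : adapted xi n (fun w => ub n w).
Proof.
elim: n => [|n IH] w w' hw //=.
by rewrite (adapted_mono (leqnSn n) IH hw) (@adapted_noise n w w' hw).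
Qed.

Lemma adapted_denoised n : adapted xi n (fun w => dn n w).
Proof.
exact: (adapted_comp2 (fun Q U => Q - U) (@adapted_rviQ n) (@adapted_avg_noise n)).
Qed.

(** The averaged noise is known before the next sample is drawn, and the noise
    is centred given the past. *)
Lemma noise_orthogonal n k :
  \int[P]_w (ub n w ord0 k * ns n w ord0 k) = 0.
Proof.
pose i := (enum_val k).1; pose u := (enum_val k).2.
pose F j w := ub n w ord0 k * sample_gap a0 p g (q n w) i u j.
have aF j : adapted xi n (F j).
  exact: (adapted_comp2 (fun U Q : Qs => U ord0 k * sample_gap a0 p g Q i u j)
    (@adapted_avg_noise n) (@adapted_rviQ n)).
have -> : \int[P]_w (ub n w ord0 k * ns n w ord0 k) =
    \int[P]_w F (xi n.+1 i u w) w.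
  by apply: eq_Rintegral => w _; rewrite /F /noise mxE.
rewrite (mean_next_sample xi_measurable xi_law xi_independent i u aF).
rewrite -[RHS](mean_cst P 0); apply: eq_Rintegral => w _.
under eq_bigr do rewrite /F mulrCA.
rewrite -mulr_sumr /sample_gap.
under eq_bigr do rewrite mulrBr.
by rewrite sumrB -mulr_suml p_sum1 mul1r subrr mulr0.
Qed.

Definition sqsum (D : Qs) : R := \sum_k D ord0 k ^+ 2.

Lemma sqsum_ge0 D : 0 <= sqsum D.
Proof. by apply: sumr_ge0 => k _; exact: sqr_ge0. Qed.

Lemma sqr_norm_le_sqsum (D : Qs) : `|D| ^+ 2 <= sqsum D.
Proof.
rewrite -(sqr_sqrtr (sqsum_ge0 D)) ler_sqr ?nnegrE ?sqrtr_ge0//.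
apply: row_norm_le => [|k]; first exact: sqrtr_ge0.
rewrite -sqrtr_sqr ler_wsqrtr// /sqsum (bigD1 k)//= lerDl.
by apply: sumr_ge0 => l _; exact: sqr_ge0.
Qed.

Variables (lam : R) (N : Qs -> R) (rho C : R).
Hypothesis lam_gt0 : 0 < lam.
Hypothesis lam_le1 : lam <= 1.
Hypothesis NP : lazy_contraction p lam N rho C.
Variable k0 : 'I_#|{: S * A}|.
Hypothesis alpha_lam : forall n, 0 <= alpha n.+1 <= lam.
Variables (r : R) (h : Qs).
Hypothesis hfix : H r h = h.

Notation rate := ((1 - rho) / lam).

Definition denoised_moment n : R := \int[P]_w (N (dn n w - h) ^+ 2).
Definition noise_moment n : R := \int[P]_w (sqsum (ub n w)).

Lemma adapted_denoised_sqr n : adapted xi n (fun w => N (dn n w - h) ^+ 2).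
Proof. exact: (adapted_comp (fun D => N (D - h) ^+ 2) (@adapted_denoised n)). Qed.

Lemma adapted_noise_sqr n : adapted xi n (fun w => sqsum (ub n w)).
Proof. exact: (adapted_comp sqsum (@adapted_avg_noise n)). Qed.

Lemma denoised_moment_ge0 n : 0 <= denoised_moment n.
Proof. by apply: mean_ge0 => w; exact: sqr_ge0. Qed.

Lemma noise_moment_ge0 n : 0 <= noise_moment n.
Proof. by apply: mean_ge0 => w; exact: sqsum_ge0. Qed.

Lemma mean_comb n b c (Y Z : Omega -> R) : adapted xi n Y -> adapted xi n Z ->
  \int[P]_w (b * Y w + c * Z w) = b * \int[P]_w Y w + c * \int[P]_w Z w.
Proof.
move=> aY aZ.
have aY' : adapted xi n (fun w => b * Y w) by exact: (adapted_comp (fun y => b * y)).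
have aZ' : adapted xi n (fun w => c * Z w) by exact: (adapted_comp (fun y => c * y)).
rewrite (mean_add P xi_measurable aY' aZ').
by rewrite (mean_scale P xi_measurable b aY) (mean_scale P xi_measurable c aZ).
Qed.

Lemma adapted_comb n b c (Y Z : Omega -> R) : adapted xi n Y -> adapted xi n Z ->
  adapted xi n (fun w => b * Y w + c * Z w).
Proof. exact: (adapted_comp2 (fun y z => b * y + c * z)). Qed.

Lemma rate_gt0 : 0 < rate.
Proof. by have /andP[_ rho1] := lc_rho NP; rewrite divr_gt0// subr_gt0. Qed.

Lemma rate_alpha_le1 n : rate * alpha n.+1 <= 1.
Proof.
have /andP[rho0 _] := lc_rho NP; have /andP[_ al] := alpha_lam n.
apply: (@le_trans _ _ (rate * lam)); first by rewrite ler_pM2l// rate_gt0.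
by rewrite divfK ?gt_eqF//; lra.
Qed.

Lemma sqr_convex (t b c : R) : 0 <= t <= 1 ->
  ((1 - t) * b + t * c) ^+ 2 <= (1 - t) * b ^+ 2 + t * c ^+ 2.
Proof.
move=> /andP[t0 t1].
have : 0 <= t * (1 - t) * (b - c) ^+ 2.
  by rewrite mulr_ge0 ?sqr_ge0// mulr_ge0// subr_ge0.
by lra.
Qed.

(** Squaring the contraction by convexity, with weights [1 - rate * alpha] and
    [rate * alpha], keeps the full contraction factor. *)
Lemma denoised_moment_recr n : denoised_moment n.+1 <=
  (1 - rate * alpha n.+1) * denoised_moment n +
  alpha n.+1 * (C ^+ 2 / rate) * noise_moment n.
Proof.
have /andP[al0 _] := alpha_lam n.
have rate0 := rate_gt0.
have a1 := adapted_mono (leqnSn n) (@adapted_denoised_sqr n).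
have a2 := adapted_mono (leqnSn n) (@adapted_noise_sqr n).
rewrite /denoised_moment /noise_moment -(mean_comb _ _ a1 a2).
apply: (mean_le P xi_measurable (@adapted_denoised_sqr n.+1)).
  exact: adapted_comb.
move=> w.
have N0 m : 0 <= N (dn m w - h) by exact: seminorm_ge0 NP k0 _.
have C0 := lc_C NP.
have step := denoised_contraction p_ge0 p_sum1 f Q0 (xs w) lam_gt0 NP alpha_lam hfix n.
set al := alpha n.+1 in al0 step *.
have t01 : 0 <= rate * al <= 1 by rewrite mulr_ge0 ?(ltW rate0)//= rate_alpha_le1.
apply: (@le_trans _ _ (((1 - rate * al) * N (dn n w - h) +
    rate * al * (C * `|ub n w| / rate)) ^+ 2)).
  have -> : rate * al * (C * `|ub n w| / rate) = al * (C * `|ub n w|).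
    by field; rewrite gt_eqF//= gt_eqF// subr_gt0; have /andP[] := lc_rho NP.
  by rewrite ler_sqr ?nnegrE ?N0//; apply: le_trans step; exact: N0.
apply: le_trans (sqr_convex _ _ t01) _; rewrite lerD2l.
have -> : rate * al * (C * `|ub n w| / rate) ^+ 2 =
    al * (C ^+ 2 / rate) * `|ub n w| ^+ 2.
  by field; rewrite gt_eqF//= gt_eqF// subr_gt0; have /andP[] := lc_rho NP.
rewrite ler_wpM2l ?sqr_norm_le_sqsum//.
by rewrite mulr_ge0// divr_ge0 ?sqr_ge0// ltW.
Qed.

Definition noise_const : R := 3 * ((gbar + N h) ^+ 2 + 1 + C ^+ 2).

Lemma noise_const_ge0 : 0 <= noise_const.
Proof. by rewrite /noise_const mulr_ge0// !addr_ge0// sqr_ge0. Qed.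

Lemma noise_sqr_le n w : `|ns n w| ^+ 2 <=
  noise_const * (1 + N (dn n w - h) ^+ 2 + sqsum (ub n w)).
Proof.
have hb := noise_bound a0 p_ge0 p_sum1 g_bounds f alpha Q0 (xs w) NP k0 h n.
have b0 := sqr_norm_le_sqsum (ub n w).
have N0 : 0 <= N (dn n w - h) by exact: seminorm_ge0 NP k0 _.
have C0 := lc_C NP.
set s := sqsum _ in b0 *; set t := N (dn n w - h) in N0 hb *.
set b := `|ub n w| in hb b0.
set G := gbar + N h in hb.
have nb : `|ns n w| ^+ 2 <= (G + t + C * b) ^+ 2.
  have hb0 : 0 <= G + t + C * b by exact: le_trans hb.
  by rewrite ler_sqr ?nnegrE.
apply: le_trans nb _.
have h3 : (G + t + C * b) ^+ 2 <= 3 * (G ^+ 2 + t ^+ 2 + C ^+ 2 * b ^+ 2).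
  have : 0 <= (G - t) ^+ 2 + (t - C * b) ^+ 2 + (G - C * b) ^+ 2.
    by rewrite !addr_ge0// sqr_ge0.
  by rewrite -exprMn; lra.
apply: le_trans h3 _; rewrite /noise_const -/G -mulrA ler_wpM2l//.
have G2 := sqr_ge0 G; have t2 := sqr_ge0 t; have C2 := sqr_ge0 C.
have s0 : 0 <= s by apply: le_trans b0; exact: sqr_ge0.
have h4 := ler_wpM2l C2 b0.
have := mulr_ge0 G2 t2; have := mulr_ge0 G2 s0; have := mulr_ge0 C2 t2.
by lra.
Qed.

(** Stated for a minorant of the squared norm so that it serves both for the norm
    and for a single coordinate. *)
Lemma mean_noise_sqr n (Y : Omega -> R) : adapted xi n.+1 Y ->
  (forall w, Y w <= `|ns n w| ^+ 2) ->
  \int[P]_w Y w <= noise_const * (1 + denoised_moment n + noise_moment n).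
Proof.
move=> aY YU.
have a1 := adapted_mono (leqnSn n) (@adapted_denoised_sqr n).
have a2 := adapted_mono (leqnSn n) (@adapted_noise_sqr n).
have a3 : adapted xi n.+1 (fun w => 1 * N (dn n w - h) ^+ 2 + 1 * sqsum (ub n w)).
  exact: adapted_comb.
have a4 : adapted xi n.+1 (fun=> 1 : R) by [].
have a5 := adapted_comb noise_const noise_const a4 a3.
apply: le_trans (mean_le P xi_measurable aY a5 _) _.
  move=> w; apply: le_trans (YU w) _; apply: le_trans (noise_sqr_le n w) _.
  by rewrite !mul1r -mulrDr addrA.
rewrite (mean_comb _ _ a4 a3) (mean_comb _ _ a1 a2) mean_cst.
by rewrite !mul1r -mulrDr addrA.
Qed.

(** The cross term vanishes coordinate by coordinate, so the noise of one step
    only contributes with weight [alpha ^+ 2]. *)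
Lemma noise_moment_recr n : noise_moment n.+1 <=
  (1 - alpha n.+1) * noise_moment n +
  #|{: S * A}|%:R * noise_const * (1 + denoised_moment n + noise_moment n)
    * alpha n.+1 ^+ 2.
Proof.
have /andP[al0 allam] := alpha_lam n.
have al1 : alpha n.+1 <= 1 by exact: le_trans lam_le1.
set al := alpha n.+1 in al0 al1 *; clear allam.
have aub k : adapted xi n.+1 (fun w => ub n w ord0 k).
  apply: (adapted_comp (fun D : Qs => D ord0 k)).
  exact: adapted_mono (leqnSn n) (@adapted_avg_noise n).
have ans k : adapted xi n.+1 (fun w => ns n w ord0 k).
  exact: (adapted_comp (fun D : Qs => D ord0 k) (@adapted_noise n)).
have aub2 k : adapted xi n.+1 (fun w => ub n w ord0 k ^+ 2).
  exact: (adapted_comp (fun y => y ^+ 2) (aub k)).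
have ans2 k : adapted xi n.+1 (fun w => ns n w ord0 k ^+ 2).
  exact: (adapted_comp (fun y => y ^+ 2) (ans k)).
have acr k : adapted xi n.+1 (fun w => ub n w ord0 k * ns n w ord0 k).
  exact: (adapted_comp2 (fun y z => y * z) (aub k) (ans k)).
have a1 k : adapted xi n.+1 (fun w => 2 * al * (1 - al) * (ub n w ord0 k * ns n w ord0 k) +
    al ^+ 2 * ns n w ord0 k ^+ 2) by exact: adapted_comb.
have coord k : \int[P]_w (ub n.+1 w ord0 k ^+ 2) <=
    (1 - al) * \int[P]_w (ub n w ord0 k ^+ 2) +
    noise_const * (1 + denoised_moment n + noise_moment n) * al ^+ 2.
  have -> : \int[P]_w (ub n.+1 w ord0 k ^+ 2) = \int[P]_w (
      (1 - al) ^+ 2 * ub n w ord0 k ^+ 2 +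
      1 * (2 * al * (1 - al) * (ub n w ord0 k * ns n w ord0 k) +
           al ^+ 2 * ns n w ord0 k ^+ 2)).
    apply: eq_Rintegral => w _; rewrite /= -/al.
    by move: (avg_noise _ _ _ _ _ _ _ _) (noise _ _ _ _ _ _ _ _) => b c; rewrite !mxE; ring.
  rewrite (mean_comb _ _ (aub2 k) (a1 k)) (mean_comb _ _ (acr k) (ans2 k)).
  rewrite noise_orthogonal mulr0 add0r mul1r; apply: lerD.
    rewrite ler_wpM2r//; first by apply: mean_ge0 => w; exact: sqr_ge0.
    by rewrite expr2 ler_piMl ?subr_ge0// gerBl.
  rewrite mulrC ler_wpM2r ?sqr_ge0//; apply: mean_noise_sqr => // w.
  by rewrite -[leLHS]real_normK ?num_real// ler_sqr ?nnegrE// row_coord_le_norm.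
set M := noise_const * (1 + _ + _) * al ^+ 2 in coord.
have -> : #|{: S * A}|%:R * noise_const * (1 + denoised_moment n + noise_moment n)
    * al ^+ 2 = #|{: S * A}|%:R * M by rewrite /M !mulrA.
clearbody M; rewrite /noise_moment /sqsum.
rewrite (@mean_sum _ _ _ _ _ P _ xi_measurable n.+1); last first.
  move=> k; apply: (adapted_comp (fun D : Qs => D ord0 k ^+ 2)).
  exact: (@adapted_avg_noise n.+1).
rewrite (@mean_sum _ _ _ _ _ P _ xi_measurable n.+1)//.
apply: le_trans (ler_sum _ (fun k _ => coord k)) _.
rewrite big_split/= -mulr_sumr lerD2l sumr_const card_ord.
by rewrite -[leLHS]mulr_natl.
Qed.

End Moments.

(** * Rates and the almost sure limit of the averaged noise *)

Section SquareBlocks.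
Variable R : realType.

Lemma sqr_sum_le n (v : nat -> R) :
  (\sum_(j < n) v j) ^+ 2 <= n%:R * \sum_(j < n) v j ^+ 2.
Proof.
elim: n => [|n IH]; first by rewrite !big_ord0 expr0n mul0r.
rewrite !big_ord_recr/=; set s := \sum_(_ < _) v _ in IH *.
set t := \sum_(_ < _) v _ ^+ 2 in IH *; set b := v n.
have cross : 2 * s * b <= t + n%:R * b ^+ 2.
  have -> : 2 * s * b = \sum_(j < n) 2 * v j * b.
    by rewrite -mulrA mulr_suml mulr_sumr; apply: eq_bigr => j _; rewrite mulrA.
  have -> : n%:R * b ^+ 2 = \sum_(j < n) b ^+ 2.
    by rewrite sumr_const card_ord mulr_natl.
  rewrite -big_split/=.
  apply: ler_sum => j _; have := sqr_ge0 (v j - b); lra.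
by rewrite -natr1; move: IH cross; lra.
Qed.

Lemma powRN_le (x y s : R) : 0 < y -> y <= x -> 0 <= s ->
  x `^ (- s) <= y `^ (- s).
Proof.
move=> y0 yx s0; have x0 : 0 < x by exact: lt_le_trans yx.
rewrite !powRN lef_pV2 ?posrE ?powR_gt0//.
by apply: ge0_ler_powR; rewrite ?nnegrE// ltW.
Qed.

Lemma square_block n K : (K.+1 ^ 2 <= n)%N ->
  exists k m, [/\ (K <= k)%N, (m <= k.*2 + 3)%N & n = (k.+1 ^ 2 + m)%N].
Proof.
move=> Kn.
have bnd k : (k.+1 ^ 2 <= n)%N -> (k <= n)%N.
  move=> kn; apply: leq_trans kn; rewrite -mulnn.
  by rewrite (leq_trans (leqnSn k))// leq_pmulr.
have [k kn kmax] := ex_maxnP (ex_intro (fun k => (k.+1 ^ 2 <= n)%N) K Kn) bnd.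
exists k, (n - k.+1 ^ 2)%N; split; last by rewrite subnKC.
- exact: kmax.
have : ~~ (k.+2 ^ 2 <= n)%N.
  by apply/negP => /kmax; rewrite ltnn.
rewrite -ltnNge leq_subLR => /ltnW/leq_trans; apply.
by rewrite -!mulnn -addnn; lia.
Qed.

End SquareBlocks.

Section Rates.
Variables (R : realType) (S A : finType) (a0 : A) (p g : S -> A -> S -> R).
Hypothesis p_ge0 : forall i u j, 0 <= p i u j.
Hypothesis p_sum1 : forall i u, \sum_j p i u j = 1.
Variable gbar : R.
Hypothesis g_bounds : forall i u j, 0 <= g i u j <= gbar.

Notation Qs := (Qspace R S A).
Notation H := (bellmanH a0 p g).

Variables (f : Qs -> R) (Q0 : Qs).
Variable a : R.
Hypothesis a_gt : 4%:R / 5%:R < a.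
Hypothesis a_le1 : a <= 1.
Notation alpha := (stepsize a).
Notation lam := (stepsize a 1%N).

Variables (d : measure_display) (Omega : measurableType d).
Variables (P : probability Omega R) (xi : nat -> S -> A -> Omega -> S).
Hypothesis xi_measurable : forall n i u j, (1 <= n)%N ->
  measurable (xi n i u @^-1` [set j]).
Hypothesis xi_law : forall n i u j, (1 <= n)%N ->
  P (xi n i u @^-1` [set j]) = (p i u j)%:E.
Hypothesis xi_independent : mutually_independent P
  [set k : nat * S * A | (1 <= k.1.1)%N]
  (fun k : nat * S * A => xi k.1.1 k.1.2 k.2).

Notation xs w := (fun m i u => xi m i u w).
Notation q n w := (rviQ a0 g f alpha Q0 (xs w) n).
Notation ns n w := (noise a0 p g f alpha Q0 (xs w) n).
Notation ub n w := (avg_noise a0 p g f alpha Q0 (xs w) n).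
Notation dn n w := (denoised a0 p g f alpha Q0 (xs w) n).

Variables (N : Qs -> R) (rho C : R).
Hypothesis NP : lazy_contraction p lam N rho C.
Variable k0 : 'I_#|{: S * A}|.
Variables (r : R) (h : Qs).
Hypothesis hfix : H r h = h.

Let lam_gt0 : 0 < lam. Proof. exact: stepsize_gt0. Qed.
Let lam_le1 : lam <= 1. Proof. exact/ltW/(stepsize1_lt1 a_gt). Qed.
Let alpha_lam n : 0 <= alpha n.+1 <= lam.
Proof. exact: stepsize_bounds. Qed.

Notation rate := ((1 - rho) / lam).
Notation Am := (denoised_moment a0 p g f alpha Q0 P xi N h).
Notation Bm := (noise_moment a0 p g f alpha Q0 P xi).
Notation nc := (noise_const gbar N C h).
Notation card := (#|{: S * A}|%:R : R).

Let Am_ge0 n : 0 <= Am n. Proof. exact: denoised_moment_ge0. Qed.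
Let Bm_ge0 n : 0 <= Bm n. Proof. exact: noise_moment_ge0. Qed.

(** The weight of the noise in [W] is large enough for its own decay to absorb
    the term by which it enters the recursion of the denoised iterates. *)
Lemma moments_rate : exists2 K, 0 <= K & forall n,
  [/\ Am n <= K, Bm n <= K & tau alpha n * (Am n + Bm n) <= K].
Proof.
have rate0 : 0 < rate by exact: rate_gt0 NP.
pose b := C ^+ 2 / rate; pose K := 2 * b + 1; pose c2 := card * nc.
have b0 : 0 <= b by rewrite divr_ge0 ?sqr_ge0// ltW.
have c20 : 0 <= c2 by rewrite mulr_ge0// noise_const_ge0.
pose W n := Am n + K * Bm n.
pose c := Num.min rate 2^-1.
have c0 : 0 < c by rewrite lt_min rate0 invr_gt0/=.
have cr : c <= rate by rewrite ge_min lexx.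
have ch : c <= 2^-1 by rewrite ge_min lexx orbT.
have K1 : 1 <= K by rewrite /K; lra.
have ABW n : Am n + Bm n <= W n by rewrite lerD2l ler_peMl.
have c1 : 0 < c <= 1 by rewrite c0/=; lra.
have [||n|L L0 LP] := @second_moment_rate _ _ a_gt W c (K * c2) c1.
- by rewrite mulr_ge0//; lra.
- by move=> n; apply: le_trans (ABW n); exact: addr_ge0.
- have hA := denoised_moment_recr p_ge0 p_sum1 f Q0 P xi_measurable lam_gt0 NP k0
    alpha_lam hfix n.
  have hB := noise_moment_recr a0 p_ge0 p_sum1 g_bounds f Q0 xi_measurable xi_law
    xi_independent lam_le1 NP k0 alpha_lam h n.
  have /andP[al0 _] := alpha_lam n.
  have A0 := Am_ge0 n; have B0 := Bm_ge0 n.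
  have ABWn := ABW n.
  rewrite -/b in hA; rewrite -/c2 in hB.
  rewrite {1}/W.
  set al := alpha n.+1 in hA hB al0 *.
  set A' := Am n.+1 in hA *; set B' := Bm n.+1 in hB *.
  set An := Am n in hA hB A0 ABWn *; set Bn := Bm n in hA hB B0 ABWn *.
  have WE : W n = An + K * Bn by [].
  set Wn := W n in ABWn WE *.
  have K0 : 0 <= K by lra.
  have hB' := ler_wpM2l K0 hB.
  (* The choice of K lets half of the decay of the noise absorb al * b * Bn. *)
  have e1 : (1 - rate * al) * An <= (1 - c * al) * An.
    by rewrite ler_wpM2r// lerB// ler_wpM2r.
  have e2 : al * b * Bn + K * ((1 - al) * Bn) <= (1 - c * al) * (K * Bn).
    have x0 : 0 <= al * (K * Bn) by rewrite !mulr_ge0.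
    have x1 : c * (al * (K * Bn)) <= 2^-1 * (al * (K * Bn)) by rewrite ler_wpM2r.
    have x2 : 0 <= al * Bn by rewrite mulr_ge0.
    by rewrite /K in x0 x1 *; move: x1; lra.
  have e3 : K * (c2 * (1 + An + Bn) * al ^+ 2) <= K * c2 * al ^+ 2 * (1 + Wn).
    have -> : K * (c2 * (1 + An + Bn) * al ^+ 2) = K * c2 * al ^+ 2 * (1 + (An + Bn)).
      by ring.
    apply: ler_wpM2l; last by rewrite lerD2l.
    by apply: mulr_ge0; [exact: mulr_ge0|exact: sqr_ge0].
  have -> : (1 - c * al + K * c2 * al ^+ 2) * Wn + K * c2 * al ^+ 2 =
    (1 - c * al) * An + (1 - c * al) * (K * Bn) + K * c2 * al ^+ 2 * (1 + Wn).
    by rewrite WE; ring.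
  by move: hA hB' e1 e2 e3; rewrite mulrDr; lra.
exists L => // n; have [WL tW] := LP n.
have A0 := Am_ge0 n; have B0 := Bm_ge0 n; have := ABW n.
split; [lra|lra|].
by apply: le_trans tW; rewrite ler_wpM2l// tau_ge0.
Qed.

(** With bounded second moments the noise is forced by a multiple of
    [alpha ^+ 2] alone. *)
Lemma noise_moment_rate : exists2 K, 0 <= K & forall n,
  Bm n <= K * n.+1%:R `^ (- (3%:R / 5%:R)).
Proof.
have [L L0 LP] := moments_rate.
pose c2 := card * nc * (1 + L + L).
have c20 : 0 <= c2.
  by apply: mulr_ge0; [rewrite mulr_ge0// noise_const_ge0|rewrite !addr_ge0].
exists (c2 * (5%:R / 2%:R)); first by rewrite mulr_ge0// divr_ge0.
apply: (averaged_noise_rate a_gt a_le1 c20) => //.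
  rewrite /noise_moment -[leRHS](mean_cst P) le_eqVlt; apply/orP; left; apply/eqP.
  apply: eq_Rintegral => w _; rewrite /= /sqsum big1// => k _.
  by rewrite mxE expr0n.
move=> n.
apply: le_trans (noise_moment_recr a0 p_ge0 p_sum1 g_bounds f Q0 xi_measurable xi_law
    xi_independent lam_le1 NP k0 alpha_lam h n) _.
rewrite lerD2l; apply: ler_wpM2r; first exact: sqr_ge0.
apply: ler_wpM2l; first by rewrite mulr_ge0// noise_const_ge0.
by have [h1 h2 _] := LP n; rewrite !lerD.
Qed.

Let incr j w : R := alpha j.+1 * (`|ub j w| + `|ns j w|).

(** Dominates the averaged noise at all times between the squares of [k + 1] and
    [k + 2]. Times are grouped along the squares because the mean of [block k] is
    then summable in [k]. *)
Let block k w : R := sqsum (ub (k.+1 ^ 2)%N w) +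
  (\sum_(j < k.*2 + 3) incr (k.+1 ^ 2 + j)%N w) ^+ 2.

Let incr_ge0 j w : 0 <= incr j w.
Proof. by rewrite mulr_ge0 ?(ltW (stepsize_gt0 _ _))// addr_ge0. Qed.

Let avg_noise_incr s m w :
  `|ub (s + m)%N w| <= `|ub s w| + \sum_(j < m) incr (s + j)%N w.
Proof.
elim: m => [|m IH]; first by rewrite addn0 big_ord0 addr0.
rewrite addnS; set U := ub _ _ in |- *; rewrite big_ord_recr/= addrA.
have /andP[al0 al] := alpha_lam (s + m)%N.
have al01 : 0 <= alpha (s + m)%N.+1 <= 1 by rewrite al0 (le_trans al).
have := avg_noise_step a0 p g f Q0 (xs w) al01; rewrite -/(incr _ _) => st.
have -> : U = ub (s + m)%N w + (U - ub (s + m)%N w).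
  by rewrite subrKC.
by apply: le_trans (ler_normD _ _) _; apply: lerD.
Qed.

Let avg_noise_le_block k m w : (m <= k.*2 + 3)%N ->
  `|ub (k.+1 ^ 2 + m)%N w| ^+ 2 <= 2 * block k w.
Proof.
move=> mk; set s := (k.+1 ^ 2)%N.
have h1 := avg_noise_incr s m w.
have h2 : \sum_(j < m) incr (s + j)%N w <= \sum_(j < k.*2 + 3) incr (s + j)%N w.
  rewrite -!(big_mkord xpredT (fun j => incr (s + j)%N w)).
  rewrite [leRHS](@big_cat_nat _ _ _ m)//= lerDl.
  by apply: sumr_ge0 => j _; exact: incr_ge0.
rewrite /block -/s; set T := \sum_(_ < _ + 3) _ in h2 *.
have h3 := sqr_norm_le_sqsum (ub s w).
have h4 : `|ub (s + m)%N w| ^+ 2 <= (`|ub s w| + T) ^+ 2.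
  have h5 : `|ub (s + m)%N w| <= `|ub s w| + T by apply: le_trans h1 _; rewrite lerD2l.
  by rewrite ler_sqr ?nnegrE//; exact: le_trans h5.
have := sqr_ge0 (`|ub s w| - T); lra.
Qed.

Let block_ge0 k w : 0 <= block k w.
Proof. by rewrite addr_ge0 ?sqsum_ge0// sqr_ge0. Qed.

Let adapted_incr j : adapted xi j.+1 (incr j).
Proof.
apply: (adapted_comp2 (fun U V : Qs => alpha j.+1 * (`|U| + `|V|))).
  exact: adapted_mono (leqnSn j) (adapted_avg_noise (n := j) a0 p g f alpha Q0).
exact: adapted_noise.
Qed.

Let block_time k (j : 'I_(k.*2 + 3)) : ((k.+1 ^ 2 + j).+1 <= k.+2 ^ 2)%N.
Proof.
move: (ltn_ord j); move: (nat_of_ord j) => i.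
by rewrite -!mulnn -addnn; lia.
Qed.

Let adapted_block k : adapted xi (k.+2 ^ 2)%N (block k).
Proof.
apply: (adapted_comp2 (fun y z => y + z ^+ 2)).
  apply: (adapted_mono (n := (k.+1 ^ 2)%N)); first by rewrite leq_exp2r.
  exact: adapted_noise_sqr.
apply: adapted_sum => j _; exact: adapted_mono (block_time j) (@adapted_incr _).
Qed.

(* Both terms are of order (k + 1) ^ (- 6 / 5): the averaged noise at time
   (k + 1) ^ 2 by noise_moment_rate, and the increments because there are at most
   3 (k + 1) of them, each with a mean square of order (k + 1) ^ (- 16 / 5). *)
Let block_mean : exists2 K, 0 <= K & forall k,
  \int[P]_w block k w <= K * k.+1%:R `^ (- 5%:R^-1 - 1).
Proof.
have [L L0 LP] := moments_rate.
have [K K0 KP] := noise_moment_rate.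
pose c3 := 2 * L + 2 * (nc * (1 + L + L)).
have c30 : 0 <= c3.
  by rewrite addr_ge0// mulr_ge0// mulr_ge0 ?noise_const_ge0// !addr_ge0.
exists (K + 9 * c3); first by rewrite addr_ge0// mulr_ge0.
move=> k; have k1 : 0 < k.+1%:R :> R by rewrite ltr0n.
set s := (k.+1 ^ 2)%N.
have sE : s%:R = k.+1%:R `^ 2 :> R by rewrite natrX -powR_mulrn.
pose T w := \sum_(j < k.*2 + 3) incr (s + j)%N w.
have aT : adapted xi (k.+2 ^ 2)%N (fun w => T w ^+ 2).
  apply: (adapted_comp (fun y => y ^+ 2)); apply: adapted_sum => j _.
  exact: adapted_mono (block_time j) (@adapted_incr _).
have aS : adapted xi (k.+2 ^ 2)%N (fun w => sqsum (ub s w)).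
  apply: (adapted_mono (n := s)); first by rewrite leq_exp2r.
  exact: adapted_noise_sqr.
have -> : \int[P]_w block k w = Bm s + \int[P]_w (T w ^+ 2).
  exact: (mean_add P xi_measurable aS aT).
rewrite mulrDl; apply: lerD.
  apply: le_trans (KP s) _; rewrite ler_wpM2l//.
  apply: (@le_trans _ _ (s%:R `^ (- (3%:R / 5%:R)))).
    by apply: powRN_le; rewrite ?ltr0n ?expn_gt0// ?ler_nat// divr_ge0.
  rewrite sE -powRrM le_eqVlt; apply/orP; left; apply/eqP; congr (_ `^ _).
  by field.
have aI2 (j : 'I_(k.*2 + 3)) :
    adapted xi (k.+2 ^ 2)%N (fun w => incr (s + j)%N w ^+ 2).
  apply: (adapted_comp (fun y => y ^+ 2)).
  exact: adapted_mono (block_time j) (@adapted_incr _).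
have aSI : adapted xi (k.+2 ^ 2)%N
    (fun w => \sum_(j < k.*2 + 3) incr (s + j)%N w ^+ 2).
  by apply: adapted_sum => j _; exact: aI2.
have incr2 (j : 'I_(k.*2 + 3)) : \int[P]_w (incr (s + j)%N w ^+ 2) <=
    k.+1%:R `^ (- (16%:R / 5%:R)) * c3.
  set t := (s + j)%N.
  have a1 : adapted xi t.+1 (fun w => sqsum (ub t w)).
    apply: (adapted_mono (leqnSn t)); exact: adapted_noise_sqr.
  have a2 : adapted xi t.+1 (fun w => `|ns t w| ^+ 2).
    apply: (adapted_comp (fun D : Qs => `|D| ^+ 2)); exact: adapted_noise.
  have aI : adapted xi t.+1 (fun w => incr t w ^+ 2).
    exact: (adapted_comp (fun y => y ^+ 2) (@adapted_incr t)).
  have ac := adapted_comb (2 * alpha t.+1 ^+ 2) (2 * alpha t.+1 ^+ 2) a1 a2.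
  apply: le_trans (mean_le P xi_measurable aI ac _) _.
    move=> w; rewrite /incr exprMn.
    have -> : 2 * alpha t.+1 ^+ 2 * sqsum (ub t w) + 2 * alpha t.+1 ^+ 2 * `|ns t w| ^+ 2
      = alpha t.+1 ^+ 2 * (2 * (sqsum (ub t w) + `|ns t w| ^+ 2)) by ring.
    apply: ler_wpM2l; first exact: sqr_ge0.
    have := sqr_norm_le_sqsum (ub t w).
    by have := sqr_ge0 (`|ub t w| - `|ns t w|); lra.
  rewrite (mean_comb P xi_measurable _ _ a1 a2) -mulrDr.
  have n2 := mean_noise_sqr p_ge0 p_sum1 g_bounds P xi_measurable NP k0 h
    a2 (fun w => lexx _).
  have [LA LB _] := LP t.
  have al2 : alpha t.+1 ^+ 2 <= k.+1%:R `^ (- (16%:R / 5%:R)).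
    apply: le_trans (stepsize_sqr_le a_gt t.+1) _.
    apply: (@le_trans _ _ (s%:R `^ (- (8%:R / 5%:R)))).
      apply: powRN_le; rewrite ?ltr0n ?expn_gt0// ?divr_ge0// ler_nat.
      by rewrite /t -addnS -addnS leq_addr.
    rewrite sE -powRrM le_eqVlt; apply/orP; left; apply/eqP; congr (_ `^ _).
    by field.
  have n3 : \int[P]_w (`|ns t w| ^+ 2) <= nc * (1 + L + L).
    by apply: le_trans n2 _; rewrite ler_wpM2l ?noise_const_ge0// !lerD.
  have N0 : 0 <= \int[P]_w (`|ns t w| ^+ 2).
    by apply: mean_ge0 => w; exact: sqr_ge0.
  have -> : 2 * alpha t.+1 ^+ 2 * (\int[P]_w sqsum (ub t w) + \int[P]_w (`|ns t w| ^+ 2))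
    = alpha t.+1 ^+ 2 * (2 * Bm t + 2 * \int[P]_w (`|ns t w| ^+ 2)).
    by rewrite /noise_moment; ring.
  apply: ler_pM => //; first exact: sqr_ge0.
    by rewrite addr_ge0// mulr_ge0.
  by rewrite /c3; lra.
have -> : 9 * c3 * k.+1%:R `^ (- 5%:R^-1 - 1) =
    (3 * k.+1%:R) ^+ 2 * (k.+1%:R `^ (- (16%:R / 5%:R)) * c3).
  have -> : - 5%:R^-1 - 1 = 2 + - (16%:R / 5%:R) :> R by field.
  rewrite powRD; last by rewrite (gt_eqF k1) implybT.
  by rewrite powR_mulrn ?(ltW k1)//; ring.
have cnt : (k.*2 + 3)%:R <= 3 * k.+1%:R :> R.
  by rewrite -natrM ler_nat -addnn; lia.
apply: (@le_trans _ _ ((k.*2 + 3)%:R *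
    \sum_(j < k.*2 + 3) \int[P]_w (incr (s + j)%N w ^+ 2))).
  rewrite -(@mean_sum _ _ _ _ _ P _ xi_measurable (k.+2 ^ 2)%N)//.
  rewrite -(mean_scale P xi_measurable _ aSI).
  apply: (mean_le P xi_measurable aT).
    exact: (adapted_comp (fun y => (k.*2 + 3)%:R * y) aSI).
  by move=> w; exact: (sqr_sum_le _ (fun j => incr (s + j)%N w)).
apply: (@le_trans _ _ ((k.*2 + 3)%:R * ((k.*2 + 3)%:R *
    (k.+1%:R `^ (- (16%:R / 5%:R)) * c3)))).
  rewrite ler_wpM2l//; apply: le_trans (ler_sum _ (fun j _ => incr2 j)) _.
  by rewrite sumr_const card_ord [leRHS]mulr_natl.
rewrite mulrA ler_wpM2r ?mulr_ge0 ?powR_ge0// -expr2 ler_sqr ?nnegrE ?mulr_ge0//.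
Qed.

Lemma avg_noise_cvg0 : {ae P, forall w, `|ub n w| @[n --> \oo] --> 0}.
Proof.
have [K K0 KP] := block_mean.
have := @summable_mean_cvg0 _ _ _ P block (K * (1 + 5%:R)) block_ge0
  (fun k => adapted_integrable P xi_measurable (@adapted_block k)).
move=> /(_ _)/filterS; apply.
- move=> w bw0; apply/cvgrPdist_le => eps eps0.
  move/cvgrPdist_le : bw0 => /(_ (eps ^+ 2 / 2)).
  have e20 : 0 < eps ^+ 2 / 2 by rewrite divr_gt0// exprn_gt0.
  move=> /(_ e20)[k1 _ k1P].
  exists (k1.+1 ^ 2)%N => // n /= /square_block[k [m [kk mk ->]]].
  rewrite sub0r normrN normr_id.
  rewrite -(@ler_sqr _ _ eps) ?nnegrE ?(ltW eps0)//.
  apply: le_trans (avg_noise_le_block w mk) _.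
  have := k1P k kk; rewrite /= sub0r normrN ger0_norm//.
  by move=> hb; rewrite mulrC -ler_pdivlMr.
- move=> n; apply: (@le_trans _ _ (\sum_(0 <= k < n) K * k.+1%:R `^ (- 5%:R^-1 - 1))).
    by apply: ler_sum => k _; exact: KP.
  rewrite -mulr_sumr ler_wpM2l//.
  case: n => [|n]; first by rewrite big_geq// addr_ge0.
  rewrite big_nat_recl//= powR1 lerD2l.
  have := @sum_powR_summable R n 5%:R^-1 _ _; rewrite invrK.
  rewrite big_add1/=.
  by apply; lra.
Qed.

End Rates.

(** * Convergence and rate *)

Section ResidualRate.
Variables (R : realType) (S A : finType) (a0 : A) (p g : S -> A -> S -> R).
Hypothesis p_ge0 : forall i u j, 0 <= p i u j.
Hypothesis p_sum1 : forall i u, \sum_j p i u j = 1.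
Variable gbar : R.
Hypothesis g_bounds : forall i u j, 0 <= g i u j <= gbar.

Notation Qs := (Qspace R S A).
Notation H := (bellmanH a0 p g).

Variables (f : Qs -> R) (Q0 : Qs).
Variable a : R.
Hypothesis a_gt : 4%:R / 5%:R < a.
Hypothesis a_le1 : a <= 1.
Notation alpha := (stepsize a).
Notation lam := (stepsize a 1%N).

Variables (d : measure_display) (Omega : measurableType d).
Variables (P : probability Omega R) (xi : nat -> S -> A -> Omega -> S).
Hypothesis xi_measurable : forall n i u j, (1 <= n)%N ->
  measurable (xi n i u @^-1` [set j]).
Hypothesis xi_law : forall n i u j, (1 <= n)%N ->
  P (xi n i u @^-1` [set j]) = (p i u j)%:E.
Hypothesis xi_independent : mutually_independent P
  [set k : nat * S * A | (1 <= k.1.1)%N]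
  (fun k : nat * S * A => xi k.1.1 k.1.2 k.2).

Variables (N : Qs -> R) (rho C : R).
Hypothesis NP : lazy_contraction p lam N rho C.
Variable k0 : 'I_#|{: S * A}|.
Variables (r : R) (h : Qs).
Hypothesis hfix : H r h = h.

Notation xs w := (fun m i u => xi m i u w).
Notation q n w := (rviQ a0 g f alpha Q0 (xs w) n).
Notation ub n w := (avg_noise a0 p g f alpha Q0 (xs w) n).
Notation dn n w := (denoised a0 p g f alpha Q0 (xs w) n).

Lemma tau_gt0 n : (0 < n)%N -> 0 < tau alpha n.
Proof.
case: n => // n _; rewrite tau_recr// ltr_wpDl ?tau_ge0//.
rewrite mulr_gt0 ?stepsize_gt0// subr_gt0.
by apply: le_lt_trans (stepsize1_lt1 a_gt); exact: stepsize_le1.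
Qed.

(** By [residual_le] and Jensen's inequality the squared mean residual is at most
    a multiple of the second moments, which decay like [1 / tau]. *)
Lemma mean_residual_rate : exists kappa : R, forall n, (1 <= n)%N ->
  ('E_P[fun w => `|q n w - H r (q n w)|%R] <= (kappa / Num.sqrt (tau alpha n))%:E)%E.
Proof.
have [K K0 KP] := moments_rate p_ge0 p_sum1 g_bounds f Q0 a_gt
  xi_measurable xi_law xi_independent NP k0 hfix.
pose c := 8 * (1 + C ^+ 2).
have c0 : 0 <= c by rewrite mulr_ge0// addr_ge0// sqr_ge0.
exists (Num.sqrt (c * K)) => n n1.
pose Y w := `|q n w - H r (q n w)|.
have aY : adapted xi n Y.
  apply: (adapted_comp (fun Q => `|Q - H r Q|)); exact: adapted_rviQ.
rewrite (mean_expectation P xi_measurable aY) lee_fin.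
have t0 := tau_gt0 n1.
have st0 : 0 < Num.sqrt (tau alpha n) by rewrite sqrtr_gt0.
rewrite ler_pdivlMr//.
set m := \int[P]_w Y w.
have m0 : 0 <= m by apply: mean_ge0 => w; exact: normr_ge0.
have aY2 : adapted xi n (fun w => Y w ^+ 2).
  exact: (adapted_comp (fun y => y ^+ 2) aY).
have aD := adapted_denoised_sqr a0 p g f alpha Q0 (xi := xi) N h (n := n).
have aU := adapted_noise_sqr a0 p g f alpha Q0 (xi := xi) (n := n).
have [_ _ tK] := KP n.
set An := denoised_moment _ _ _ _ _ _ _ _ _ _ _ in tK.
set Bn := noise_moment _ _ _ _ _ _ _ _ _ in tK.
have A0 : 0 <= An by exact: denoised_moment_ge0.
have B0 : 0 <= Bn by exact: noise_moment_ge0.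
have m2 : m ^+ 2 <= c * (An + Bn).
  apply: le_trans (mean_sqr_le P xi_measurable aY) _.
  apply: le_trans (mean_le P xi_measurable aY2 (adapted_comb 8 (8 * C ^+ 2) aD aU) _) _.
    move=> w; have := residual_le p_ge0 p_sum1 f alpha Q0 (xs w) NP k0 hfix n.
    rewrite -/(Y w); set t := N _; set b := `|avg_noise _ _ _ _ _ _ _ _| => hY.
    have Y0 : 0 <= Y w by exact: normr_ge0.
    have h1 : Y w ^+ 2 <= (2 * (t + C * b)) ^+ 2.
      by rewrite ler_sqr ?nnegrE//; exact: le_trans hY.
    have h2 := ler_wpM2l (sqr_ge0 C) (sqr_norm_le_sqsum (ub n w)).
    rewrite -/b in h2.
    have := sqr_ge0 (t - C * b); move: h1 h2.
    by set y := Y w; set z := sqsum _; clearbody t b y z; lra.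
  rewrite (mean_comb P xi_measurable _ _ aD aU).
  rewrite -[X in 8 * X + _]/An -[X in _ + _ * X]/Bn /c.
  have := mulr_ge0 (sqr_ge0 C) A0; lra.
rewrite -(ger0_norm m0) -sqrtr_sqr -sqrtrM ?sqr_ge0// ler_wsqrtr//.
apply: le_trans (ler_wpM2r (ltW t0) m2) _.
by rewrite -mulrA [_ * tau _ _]mulrC ler_wpM2l.
Qed.

End ResidualRate.

Theorem theorem3p2 (R : realType) (S A : finType) (i0 : S) (a0 : A)
  (p g : S -> A -> S -> R) (gbar : R)
  (p_ge0 : forall i u j, 0 <= p i u j)
  (p_sum1 : forall i u, \sum_(j : S) p i u j = 1)
  (g_bounds : forall i u j, 0 <= g i u j <= gbar)
  (p_unichain : unichain p)
  (f : Qspace R S A -> R)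
  (f_continuous : continuous f)
  (f_shift : forall (Q : Qspace R S A) (c : R),
      f (Q + c *: const_mx 1) = f Q + c)
  (d : measure_display) (Omega : measurableType d) (P : probability Omega R)
  (xi : nat -> S -> A -> Omega -> S)
  (xi_measurable : forall n i u j, (1 <= n)%N ->
      measurable (xi n i u @^-1` [set j]))
  (xi_law : forall n i u j, (1 <= n)%N ->
      P (xi n i u @^-1` [set j]) = (p i u j)%:E)
  (xi_independent : mutually_independent P
      [set k : nat * S * A | (1 <= k.1.1)%N]
      (fun k : nat * S * A => xi k.1.1 k.1.2 k.2))
  (a : R) (a_gt : 4%:R / 5%:R < a) (a_le1 : a <= 1)
  (Q0 : Qspace R S A) :
  let rbar := opt_reward a0 p g i0 in
  let H := bellmanH a0 p g rbar in
  let alpha := stepsize a in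
  let Q := fun (n : nat) (w : Omega) =>
    rviQ a0 g f alpha Q0 (fun m i u => xi m i u w) n in
  (exists Qstar : Qspace R S A,
     [/\ H Qstar = Qstar, f Qstar = rbar,
         forall Q' : Qspace R S A, H Q' = Q' -> f Q' = rbar -> Q' = Qstar
       & {ae P, forall w, (f (Q n w) @[n --> \oo] --> rbar) /\
                          (Q n w @[n --> \oo] --> Qstar)}])
  /\
  (exists kappa : R,
     [/\ forall n : nat, (1 <= n)%N ->
           ('E_P[fun w => `|Q n w - H (Q n w)|%R]
            <= (kappa / Num.sqrt (tau alpha n))%:E)%E,
         a < 1 -> (fun n : nat => kappa / Num.sqrt (tau alpha n) : R^o) =O_\oo
                  (fun n : nat => 1 / Num.sqrt (n%:R `^ (1 - a)) : R^o)
       & a = 1 -> (fun n : nat => kappa / Num.sqrt (tau alpha n) : R^o) =O_\oo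
                  (fun n : nat => 1 / Num.sqrt (ln n%:R) : R^o)]).
Proof.
move=> rbar H alpha Q.
have lam0 : 0 < stepsize a 1%N by exact: stepsize_gt0.
have lam1 := stepsize1_lt1 a_gt.
pose k0 : 'I_#|{: S * A}| := enum_rank (i0, a0).
have [N [rho [C NP]]] :=
  contracting_seminorm p_ge0 p_sum1 p_unichain lam0 lam1 i0 a0.
have g_ge0 i u j : 0 <= g i u j by case/andP: (g_bounds i u j).
have [Q1 hQ1] : exists Q1, H Q1 = Q1.
  have [r [Q1 hQ1]] := bellman_fixed_exists a0 g lam0 NP k0.
  by exists Q1; rewrite /H /rbar (opt_reward_fixed p_ge0 p_sum1 g_ge0 hQ1).
pose Qstar := Q1 + (rbar - f Q1) *: const_mx 1.
have hQ : H Qstar = Qstar by rewrite /H bellman_shift// -/H hQ1.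
have fQ : f Qstar = rbar by rewrite f_shift subrKC.
split.
  exists Qstar; split=> //.
    move=> Q' hQ' fQ'.
    have cE := bellman_fixed_unique lam0 NP k0 hQ' hQ.
    pose c := (Q' - Qstar) ord0 k0.
    have Q'E : Q' = Qstar + c *: const_mx 1 by rewrite /c -cE subrKC.
    have c0 : c = 0.
      by move: fQ'; rewrite Q'E f_shift fQ -[RHS]addr0 => /addrI.
    by rewrite Q'E c0 scale0r addr0.
  have := avg_noise_cvg0 p_ge0 p_sum1 g_bounds f Q0 a_gt a_le1
    xi_measurable xi_law xi_independent NP k0 hQ.
  apply: filterS => w noise0.
  apply: (iterates_cvg p_ge0 p_sum1 f_continuous f_shift lam0 (ltW lam1) NP k0
    _ _ hQ fQ noise0).
    by move=> n; exact: stepsize_bounds.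
  by move=> M; exact: sum_stepsize_unbounded.
have [kappa kP] := mean_residual_rate p_ge0 p_sum1 g_bounds f Q0 a_gt
  xi_measurable xi_law xi_independent NP k0 hQ.
exists kappa; split=> // _.
  have [c c0 cP] := tau_polynomial a_gt.
  apply: (residual_rate_bigO kappa c0); exists 1%N => // n /= n1.
  by rewrite cP// powR_gt0// ltr0n.
have [c c0 cP] := tau_logarithmic a_gt a_le1.
by apply: (residual_rate_bigO kappa c0); exists 4%N => // n /= n4; exact: cP.
Qed.
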